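(* Let $A$ be a ring and let $d=(d_i)_{i\in I}$ be a family of derivations of $A$. Let $(B,\delta)$, with $\delta=(\delta_i)_{i\in I}$, be a differential $(A,d)$-algebra such that $B$ is finitely generated and free as an $A$-module, of rank $\ell\geq 1$. Then: (i) The functor $F^{\mathrm{diff}}$ from the category of differential $(A,d)$-algebras to the category of differential $(B,\delta)$-algebras that sends $(C,\eta)$ to $(C\otimes_A B,(\eta_i\otimes\delta_i)_{i\in I})$ (and a morphism $\phi$ to $\phi\otimes\mathrm{id}_B$) has a left adjoint $W^{\mathrm{diff}}$. It sends $(D,\partial)$ to $(W(D),\partial^W)$, where $\partial^W=(\partial_i^W)_{i\in I}$, and a morphism $f$ to $W(f)$. (ii) Let $(C,\eta)$ be a differential $(A,d)$-algebra and let $(D,\partial)$ be a differential $(B,\delta)$-algebra. Then the bijection $$\tau(D,C):\mathrm{Hom}_{A\text{-}\mathrm{Alg}}(W(D),C)\longrightarrow\mathrm{Hom}_{B\text{-}\mathrm{Alg}}(D,C\otimes_A B),\quad \phi\longmapsto(\phi\otimes\mathrm{id}_B)\circ W_D$$ of the classical Weil descent restricts to a bijection $$\mathrm{Hom}_{(A,d)\text{-}\mathrm{Alg}}(W^{\mathrm{diff}}(D,\partial),(C,\eta))\longrightarrow\mathrm{Hom}_{(B,\delta)\text{-}\mathrm{Alg}}((D,\partial),F^{\mathrm{diff}}(C,\eta)).$$ (iii) If $(D,\partial)$ is a differential $(B,\delta)$-algebra and the derivations $\partial=(\partial_i)_{i\in I}$ are Lie commuting with structure coefficients $a_{ij}^k\in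 A$ $(i,j,k\in I)$, i.e. for fixed $i,j\in I$ only finitely many of the $a_{ij}^k$ are nonzero and $$[\partial_i,\partial_j]=\sum_{k\in I}a_{ij}^k\,\partial_k\qquad(i,j\in I),$$ then the derivations $(\partial_i^W)_{i\in I}$ of $W(D)$ are also Lie commuting with structure coefficients $a_{ij}^k$.
   Context: All rings and algebras are commutative and unital, and their homomorphisms are unital; the characteristic is arbitrary. A derivation of a ring $R$ is an additive map $R\to R$ satisfying the Leibniz rule; $[\partial_1,\partial_2]=\partial_1\partial_2-\partial_2\partial_1$. For a ring $A$ with a family of derivations $d=(d_i)_{i\in I}$, a differential $(A,d)$-algebra is an $A$-algebra $C$ with derivations $\eta=(\eta_i)_{i\in I}$ of $C$ such that for every $i\in I$ the structure map $A\to C$ is a differential morphism $(A,d_i)\to(C,\eta_i)$, i.e. commutes with the derivations. The category $(A,d)\text{-}\mathrm{Alg}$ has differential $(A,d)$-algebras as objects and as morphisms the $A$-algebra homomorphisms commuting with the $i$-th derivations for all $i\in I$. For each $i$, $\eta_i\otimes\delta_i$ denotes the unique derivation on $C\otimes_A B$ for which the natural maps $(C,\eta_i)\to C\otimes_A B$ and $(B,\delta_i)\to C\otimes_A B$ are differential; explicitly $(\eta_i\otimes\delta_i)(c\otimes b)=\eta_i(c)\otimes b+c\otimes\delta_i(b)$. Classical Weil descent: the functor $F$ from $A$-algebras to $B$-algebras, $F(C)=C\otimes_A B$, $F(\phi)=\phi\otimes\mathrm{id}_B$, has a left adjoint $W$. For every $B$-algebra $D$, the $A$-algebra $W(D)$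 together with the $B$-algebra homomorphism $W_D:D\to W(D)\otimes_A B$ (the unit at $D$) is determined up to unique isomorphism by the property that for every $A$-algebra $C$ the map $\tau(D,C):\phi\mapsto(\phi\otimes\mathrm{id}_B)\circ W_D$ is a bijection from $A$-algebra homomorphisms $W(D)\to C$ to $B$-algebra homomorphisms $D\to C\otimes_A B$. For a $B$-algebra homomorphism $f:D\to D'$, $W(f):W(D)\to W(D')$ is the unique $A$-algebra homomorphism with $(W(f)\otimes\mathrm{id}_B)\circ W_D=W_{D'}\circ f$. The derivations $\partial_i^W$: for a differential $(B,\delta)$-algebra $(D,\partial)$ and $i\in I$, $\partial_i^W$ is the unique derivation of $W(D)$ such that the structure map $(A,d_i)\to(W(D),\partial_i^W)$ is differential and $W_D\circ\partial_i=(\partial_i^W\otimes\delta_i)\circ W_D$. *)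

(* Defs.v *)
From HB Require Import structures.
From mathcomp Require Import all_boot all_order all_algebra.
From mathcomp Require Import all_classical.

Set Implicit Arguments.
Unset Strict Implicit.
Unset Printing Implicit Defensive.

Import GRing.Theory.
Local Open Scope quotient_scope.
Local Open Scope ring_scope.

(* Rings are [comPzRingType]s, so that the zero ring is allowed: W(D) may well
   be zero.  MathComp's [comAlgType] excludes it, hence algebras are presented
   by their structure map. *)
Record algebra (A : comPzRingType) := MkAlgebra {
  alg_sort :> comPzRingType;
  alg_map : {rmorphism A -> alg_sort}
}.

Record alg_hom (A : comPzRingType) (C D : algebra A) := MkAlgHom {
  alg_hom_fun :> {rmorphism C -> D};
  alg_hom_map : forall a, alg_hom_fun (alg_map C a) = alg_map D a
}.

Lemma alg_hom_eq (A : comPzRingType) (C D : algebra A) (f g : alg_hom C D) :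
  f =1 g -> f = g.
Proof.
case: f g => [f fA] [g gA] /= fg.
have efg : f = g :> {rmorphism C -> D}.
  case: f g fg {fA gA} => [f [[hf1] [hf2]]] [g [[hg1] [hg2]]] /= /funext fg.
  by subst g; rewrite (Prop_irrelevance hf1 hg1) (Prop_irrelevance hf2 hg2).
by subst g; rewrite (Prop_irrelevance fA gA).
Qed.

Definition alg_id (A : comPzRingType) (C : algebra A) : alg_hom C C :=
  @MkAlgHom A C C idfun (fun=> erefl).

Lemma alg_comp_map (A : comPzRingType) (C D E : algebra A)
  (g : alg_hom D E) (f : alg_hom C D) (a : A) :
  (g \o f) (alg_map C a) = alg_map E a.
Proof. by rewrite /= !alg_hom_map. Qed.

Definition alg_comp (A : comPzRingType) (C D E : algebra A)
    (g : alg_hom D E) (f : alg_hom C D) : alg_hom C E :=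
  @MkAlgHom A C E (GRing.RMorphism.clone _ _ (g \o f) _) (alg_comp_map g f).

Definition restrict_scalars (A : comPzRingType) (B : algebra A)
    (D : algebra B) : algebra A :=
  @MkAlgebra A D (GRing.RMorphism.clone _ _ (alg_map D \o alg_map B) _).

Definition free_of_rank (A : comPzRingType) (B : algebra A) (l : nat) : Prop :=
  exists e : 'I_l -> B, forall b : B,
    exists! c : {ffun 'I_l -> A}, b = \sum_j alg_map B (c j) * e j.

Section TensorProduct.
Variables (A : comPzRingType) (C B : algebra A).

(* The list [:: (c1, b1); ...; (cn, bn)] stands for the formal sum of the
   ci (x) bi.  No formal opposites are needed: [(- c, b)] is an opposite of
   [(c, b)] by [tensor_addl] and [tensor_zero]. *)
Inductive tensor_rel : seq (C * B) -> seq (C * B) -> Prop :=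
| tensor_refl s : tensor_rel s s
| tensor_sym s t : tensor_rel s t -> tensor_rel t s
| tensor_trans s t u : tensor_rel s t -> tensor_rel t u -> tensor_rel s u
| tensor_cat s s' t t' :
    tensor_rel s s' -> tensor_rel t t' -> tensor_rel (s ++ t) (s' ++ t')
| tensor_swap s t : tensor_rel (s ++ t) (t ++ s)
| tensor_zero b : tensor_rel [:: (0, b)] [::]
| tensor_addl c c' b : tensor_rel [:: (c + c', b)] [:: (c, b); (c', b)]
| tensor_addr c b b' : tensor_rel [:: (c, b + b')] [:: (c, b); (c, b')]
| tensor_scale a c b :
    tensor_rel [:: (alg_map C a * c, b)] [:: (c, alg_map B a * b)].

Definition tensor_relb (s t : seq (C * B)) : bool := `[< tensor_rel s t >].

Lemma tensor_relb_equiv : equiv_class_of tensor_relb.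
Proof.
split=> [s|s t|t s u]; first exact/asboolP/tensor_refl.
- by apply/asboolP/asboolP; exact: tensor_sym.
- by move=> /asboolP st /asboolP tu; apply/asboolP/(tensor_trans st tu).
Qed.

Canonical tensor_equiv := EquivRelPack tensor_relb_equiv.

Definition tensor := {eq_quot tensor_equiv}.
HB.instance Definition _ := Choice.on tensor.
HB.instance Definition _ := EqQuotient.on tensor.

Definition tens (c : C) (b : B) : tensor := \pi_tensor [:: (c, b)].

Lemma tensor_piP (s t : seq (C * B)) :
  tensor_rel s t <-> \pi_tensor s = \pi_tensor t.
Proof.
split=> [st|/eqquotP/asboolP //].
by apply/eqquotP; exact/asboolP.
Qed.

Lemma tensor_reprK (s : seq (C * B)) : tensor_rel (repr (\pi_tensor s)) s.
Proof. by apply/tensor_piP; rewrite reprK. Qed.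

Definition tensor0 : tensor := \pi_tensor [::].
Definition tensorD (x y : tensor) : tensor := \pi_tensor (repr x ++ repr y).

Lemma pi_tensorD (s t : seq (C * B)) :
  tensorD (\pi_tensor s) (\pi_tensor t) = \pi_tensor (s ++ t).
Proof. by apply/tensor_piP/tensor_cat; exact: tensor_reprK. Qed.

Lemma tensorDA : associative tensorD.
Proof.
move=> x y z; rewrite -[x]reprK -[y]reprK -[z]reprK.
rewrite (pi_tensorD (repr y)) (pi_tensorD (repr x)).
by rewrite (pi_tensorD (repr x)) (pi_tensorD (_ ++ _)) catA.
Qed.

Lemma tensorDC : commutative tensorD.
Proof. by move=> x y; apply/tensor_piP; exact: tensor_swap. Qed.

Lemma tensor0D : left_id tensor0 tensorD.
Proof. by move=> x; rewrite -[x]reprK pi_tensorD. Qed.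


HB.instance Definition _ :=
  GRing.isNmodule.Build tensor tensorDA tensorDC tensor0D.

Lemma pi_tensorE (s : seq (C * B)) :
  \pi_tensor s = \sum_(p <- s) tens p.1 p.2.
Proof.
elim: s => [|[c b] s IHs]; first by rewrite big_nil.
by rewrite big_cons -IHs -cat1s -pi_tensorD.
Qed.

Lemma tensDl (c c' : C) (b : B) : tens (c + c') b = tens c b + tens c' b.
Proof.
have /tensor_piP e := tensor_addl c c' b.
by rewrite [LHS]e pi_tensorE !big_cons big_nil addr0.
Qed.

Lemma tensDr (c : C) (b b' : B) : tens c (b + b') = tens c b + tens c b'.
Proof.
have /tensor_piP e := tensor_addr c b b'.
by rewrite [LHS]e pi_tensorE !big_cons big_nil addr0.
Qed.

Lemma tens0l (b : B) : tens 0 b = 0.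
Proof. by apply/tensor_piP; exact: tensor_zero. Qed.

Lemma tensZ (a : A) (c : C) (b : B) :
  tens (alg_map C a * c) b = tens c (alg_map B a * b).
Proof. by apply/tensor_piP; exact: tensor_scale. Qed.

(* c (x) b |-> f c b, extended additively.  Defined through a representative,
   hence only meaningful for a balanced [f]: see [tlift_pi]. *)
Definition tlift (M : nmodType) (f : C -> B -> M) (x : tensor) : M :=
  \sum_(p <- repr x) f p.1 p.2.

Definition balanced (M : nmodType) (f : C -> B -> M) : Prop :=
  [/\ forall b, f 0 b = 0,
      forall c c' b, f (c + c') b = f c b + f c' b,
      forall c b b', f c (b + b') = f c b + f c b'
    & forall a c b, f (alg_map C a * c) b = f c (alg_map B a * b)].

Lemma tlift_pi (M : nmodType) (f : C -> B -> M) (s : seq (C * B)) :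
  balanced f -> tlift f (\pi_tensor s) = \sum_(p <- s) f p.1 p.2.
Proof.
move=> [f0 fDl fDr fZ]; rewrite /tlift.
have := tensor_reprK s; move: (repr _) => t; elim => {s t} //.
- by move=> s t u _ -> _ ->.
- by move=> s s' t t' _ es _ et; rewrite !big_cat /= es et.
- by move=> s t; rewrite !big_cat /= addrC.
- by move=> b; rewrite big_seq1 big_nil f0.
- by move=> c c' b; rewrite !big_cons !big_nil !addr0 fDl.
- by move=> c b b'; rewrite !big_cons !big_nil !addr0 fDr.
- by move=> a c b; rewrite !big_cons !big_nil !addr0 fZ.
Qed.

Lemma tlift_tens (M : nmodType) (f : C -> B -> M) (c : C) (b : B) :
  balanced f -> tlift f (tens c b) = f c b.
Proof. by move=> fB; rewrite tlift_pi// big_seq1. Qed.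

Lemma tliftD (M : nmodType) (f : C -> B -> M) (x y : tensor) :
  balanced f -> tlift f (x + y) = tlift f x + tlift f y.
Proof.
move=> fB; rewrite -[x]reprK -[y]reprK.
have -> : \pi_tensor (repr x) + \pi_tensor (repr y) =
    \pi_tensor (repr x ++ repr y) :> tensor by exact: pi_tensorD.
by rewrite !tlift_pi// big_cat.
Qed.

Lemma tlift0 (M : nmodType) (f : C -> B -> M) :
  balanced f -> tlift f 0 = 0.
Proof. by move=> fB; have := tlift_pi [::] fB; rewrite big_nil. Qed.

Lemma tensor_ind (P : tensor -> Prop) :
  P 0 -> (forall c b x, P x -> P (tens c b + x)) -> forall x, P x.
Proof.
move=> P0 PD x; rewrite -[x]reprK pi_tensorE.
by elim: (repr x) => [|[c b] s IHs]; rewrite ?big_nil ?big_cons//; exact: PD.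
Qed.

Lemma tens_balanced_opp : balanced (fun c b => tens (- c) b).
Proof.
split=> [b|c c' b|c b b'|a c b]; rewrite ?oppr0 ?tens0l ?opprD ?tensDl ?tensDr//.
by rewrite -mulrN tensZ.
Qed.

Definition tensorN : tensor -> tensor := tlift (fun c b => tens (- c) b).

Lemma tensorND : left_inverse 0 tensorN +%R.
Proof.
move=> x; have oB := tens_balanced_opp; rewrite /tensorN.
elim/tensor_ind: x => [|c b x IHx]; first by rewrite tlift0// addr0.
by rewrite tliftD// tlift_tens// addrACA IHx addr0 -tensDl addNr tens0l.
Qed.

HB.instance Definition _ := GRing.Nmodule_isZmodule.Build tensor tensorND.

(* (c (x) b) * (c' (x) b') = (c * c') (x) (b * b') *)
Definition tensorM (x y : tensor) : tensor :=
  tlift (fun c b => tlift (fun c' b' => tens (c * c') (b * b')) y) x.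

Lemma tensM_balanced (c : C) (b : B) :
  balanced (fun c' b' => tens (c * c') (b * b')).
Proof.
split=> [b'|c1 c2 b'|c' b1 b2|a c' b'].
- by rewrite mulr0 tens0l.
- by rewrite mulrDr tensDl.
- by rewrite mulrDr tensDr.
- by rewrite !(mulrCA _ (alg_map _ a)) tensZ.
Qed.

Lemma tensM_lift_balanced (y : tensor) :
  balanced (fun c b => tlift (fun c' b' => tens (c * c') (b * b')) y).
Proof.
split=> [b|c1 c2 b|c b1 b2|a c b]; elim/tensor_ind: y => [|c' b' y IHy];
  rewrite ?tlift0 ?tliftD ?tlift_tens ?addr0//; try exact: tensM_balanced.
- by rewrite mul0r tens0l add0r.
- by rewrite IHy mulrDl tensDl addrACA.
- by rewrite IHy mulrDl tensDr addrACA.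
- by rewrite IHy -!mulrA tensZ.
Qed.

Lemma tensM (c c' : C) (b b' : B) :
  tensorM (tens c b) (tens c' b') = tens (c * c') (b * b').
Proof.
rewrite /tensorM tlift_tens; last exact: tensM_lift_balanced.
by rewrite tlift_tens//; exact: tensM_balanced.
Qed.

Lemma tensorMDl : left_distributive tensorM +%R.
Proof.
by move=> x y z; rewrite /tensorM tliftD//; exact: tensM_lift_balanced.
Qed.

Lemma tensor0M (y : tensor) : tensorM 0 y = 0.
Proof. by rewrite /tensorM tlift0//; exact: tensM_lift_balanced. Qed.

Lemma tensorMDr : right_distributive tensorM +%R.
Proof.
move=> x y z; elim/tensor_ind: x => [|c b x IHx].
  by rewrite !tensor0M addr0.
rewrite !tensorMDl IHx addrACA; congr (_ + _).
rewrite /tensorM !tlift_tens; try exact: tensM_lift_balanced.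
by rewrite tliftD//; exact: tensM_balanced.
Qed.

Lemma tensorM0 (x : tensor) : tensorM x 0 = 0.
Proof.
apply: (@addrI _ (tensorM x 0)).
by rewrite -tensorMDr !addr0.
Qed.

Lemma tensorMC : commutative tensorM.
Proof.
move=> x y; elim/tensor_ind: x => [|c b x IHx].
  by rewrite tensor0M tensorM0.
rewrite tensorMDl tensorMDr {}IHx; congr (_ + _).
elim/tensor_ind: y => [|c' b' y IHy]; first by rewrite tensor0M tensorM0.
by rewrite tensorMDl tensorMDr {}IHy !tensM (mulrC c) (mulrC b).
Qed.

Lemma tensorMA : associative tensorM.
Proof.
move=> x y z; elim/tensor_ind: x => [|c b x IHx]; first by rewrite !tensor0M.
rewrite !tensorMDl {}IHx; congr (_ + _).
elim/tensor_ind: y => [|c' b' y IHy].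
  by rewrite tensorM0 !tensor0M tensorM0.
rewrite tensorMDl !tensorMDr tensorMDl {}IHy; congr (_ + _).
elim/tensor_ind: z => [|c2 b2 z IHz]; first by rewrite !tensorM0.
by rewrite !tensorMDr {}IHz !tensM !mulrA.
Qed.

Lemma tensor1M : left_id (tens 1 1) tensorM.
Proof.
move=> x; elim/tensor_ind: x => [|c b x IHx]; first by rewrite tensorM0.
by rewrite tensorMDr IHx tensM !mul1r.
Qed.

HB.instance Definition _ := GRing.Zmodule_isComPzRing.Build tensor
  tensorMA tensorMC tensor1M tensorMDl.

Lemma tensME (c c' : C) (b b' : B) :
  tens c b * tens c' b' = tens (c * c') (b * b').
Proof. exact: tensM. Qed.

End TensorProduct.

(* The B-algebra F(C) = C (x)_A B, with structure map b |-> 1 (x) b. *)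
Section BaseChange.
Variables (A : comPzRingType) (B : algebra A).

Section Object.
Variable C : algebra A.

Definition tens1 (b : B) : tensor C B := tens 1 b.

Lemma tens1_nmod_morphism : nmod_morphism tens1.
Proof.
have D x y : tens1 (x + y) = tens1 x + tens1 y by exact: tensDr.
by split=> //; apply: (@addrI _ (tens1 0)); rewrite -D !addr0.
Qed.

Lemma tens1_monoid_morphism : monoid_morphism tens1.
Proof. by split=> // x y; rewrite /tens1 tensME mulr1. Qed.

HB.instance Definition _ :=
  GRing.isNmodMorphism.Build B (tensor C B) tens1 tens1_nmod_morphism.
HB.instance Definition _ :=
  GRing.isMonoidMorphism.Build B (tensor C B) tens1 tens1_monoid_morphism.

Definition base_change : algebra B := @MkAlgebra B (tensor C B) tens1.

End Object.

Section Map.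
Variables (C C' : algebra A) (phi : alg_hom C C').

Definition tensor_map : tensor C B -> tensor C' B :=
  tlift (fun c b => tens (phi c) b).

Lemma tensor_map_balanced :
  balanced (fun (c : C) (b : B) => tens (phi c) b).
Proof.
split=> [b|c c' b|c b b'|a c b]; rewrite ?tensDr//.
- by rewrite rmorph0 tens0l.
- by rewrite rmorphD tensDl.
- by rewrite rmorphM alg_hom_map tensZ.
Qed.

Lemma tensor_map_tens (c : C) (b : B) :
  tensor_map (tens c b) = tens (phi c) b.
Proof. exact/tlift_tens/tensor_map_balanced. Qed.

Lemma tensor_map_nmod_morphism : nmod_morphism tensor_map.
Proof.
split=> [|x y]; first exact/tlift0/tensor_map_balanced.
exact/tliftD/tensor_map_balanced.
Qed.

HB.instance Definition _ := GRing.isNmodMorphism.Build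
  (tensor C B) (tensor C' B) tensor_map tensor_map_nmod_morphism.

Lemma tensor_map_monoid_morphism : monoid_morphism tensor_map.
Proof.
split=> [|x y]; first by rewrite tensor_map_tens rmorph1.
elim/tensor_ind: x => [|c b x IHx]; first by rewrite !(mul0r, raddf0).
rewrite mulrDl !raddfD/= mulrDl {}IHx; congr (_ + _).
elim/tensor_ind: y => [|c' b' y IHy]; first by rewrite !(mulr0, raddf0).
rewrite mulrDr !raddfD/= mulrDr IHy; congr (_ + _).
by rewrite tensME !tensor_map_tens tensME rmorphM.
Qed.

HB.instance Definition _ := GRing.isMonoidMorphism.Build
  (tensor C B) (tensor C' B) tensor_map tensor_map_monoid_morphism.

Lemma tensor_map_alg (b : B) :
  tensor_map (alg_map (base_change C) b) = alg_map (base_change C') b.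
Proof. by rewrite [LHS]tensor_map_tens rmorph1. Qed.

(* phi (x) id_B *)
Definition base_change_map : alg_hom (base_change C) (base_change C') :=
  @MkAlgHom B (base_change C) (base_change C') tensor_map tensor_map_alg.

End Map.
End BaseChange.

Record derivation (R : comPzRingType) := MkDerivation {
  der_fun :> {additive R -> R};
  derM : forall x y, der_fun (x * y) = der_fun x * y + x * der_fun y
}.

Lemma der1 (R : comPzRingType) (d : derivation R) : d 1 = 0.
Proof.
by apply: (@addrI _ (d 1)); rewrite addr0 -[in RHS](mulr1 1) derM mulr1 mul1r.
Qed.

Definition differential (R S : comPzRingType) (d : derivation R)
  (e : derivation S) (f : R -> S) : Prop := forall x, e (f x) = f (d x).

Record diff_algebra (A : comPzRingType) (I : Type) (d : I -> derivation A) :=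
  MkDiffAlgebra {
    diff_alg :> algebra A;
    diff_der : I -> derivation diff_alg;
    diff_algP : forall i, differential (d i) (diff_der i) (alg_map diff_alg)
  }.

Definition is_diff_hom (A : comPzRingType) (I : Type) (d : I -> derivation A)
    (C D : diff_algebra d) (f : alg_hom C D) : Prop :=
  forall i, differential (diff_der C i) (diff_der D i) f.

Record diff_hom (A : comPzRingType) (I : Type) (d : I -> derivation A)
    (C D : diff_algebra d) := MkDiffHom {
  diff_hom_alg :> alg_hom C D;
  diff_homP : is_diff_hom diff_hom_alg
}.

Lemma diff_hom_eq (A : comPzRingType) (I : Type) (d : I -> derivation A)
  (C D : diff_algebra d) (f g : diff_hom C D) : f =1 g -> f = g.
Proof.
case: f g => [f fP] [g gP] /= /alg_hom_eq fg.
by subst g; rewrite (Prop_irrelevance fP gP).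
Qed.

Lemma alg_id_diff (A : comPzRingType) (I : Type) (d : I -> derivation A)
  (C : diff_algebra d) : @is_diff_hom A I d C C (alg_id C).
Proof. by []. Qed.

Lemma alg_comp_diff (A : comPzRingType) (I : Type) (d : I -> derivation A)
  (C D E : diff_algebra d) (g : diff_hom D E) (f : diff_hom C D) :
  @is_diff_hom A I d C E (alg_comp g f).
Proof. by move=> i x /=; rewrite diff_homP diff_homP. Qed.

Definition diff_id (A : comPzRingType) (I : Type) (d : I -> derivation A)
    (C : diff_algebra d) : diff_hom C C := @MkDiffHom A I d C C (alg_id C) (@alg_id_diff A I d C).

Definition diff_comp (A : comPzRingType) (I : Type) (d : I -> derivation A)
    (C D E : diff_algebra d) (g : diff_hom D E) (f : diff_hom C D) :
    diff_hom C E := @MkDiffHom A I d C E (alg_comp g f)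
    (@alg_comp_diff A I d C D E g f).

(* The derivation e (x) f of C (x)_A B, c (x) b |-> e c (x) b + c (x) f b, for
   derivations e of C and f of B extending a common derivation d of A. *)
Section TensorDerivation.
Variables (A : comPzRingType) (C B : algebra A).
Variables (d : derivation A) (e : derivation C) (f : derivation B).
Hypothesis eP : differential d e (alg_map C).
Hypothesis fP : differential d f (alg_map B).

Definition tensor_der_fun : tensor C B -> tensor C B :=
  tlift (fun c b => tens (e c) b + tens c (f b)).

Lemma tensor_der_balanced :
  balanced (fun c b => tens (e c) b + tens c (f b)).
Proof.
split=> [b|c c' b|c b b'|a c b].
- by rewrite raddf0 !tens0l addr0.
- by rewrite raddfD !tensDl addrACA.
- by rewrite raddfD !tensDr addrACA.
- by rewrite !derM eP fP tensDl tensDr !tensZ addrA [X in X + _]addrC -addrA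
    addrCA addrA.
Qed.

Lemma tensor_der_tens (c : C) (b : B) :
  tensor_der_fun (tens c b) = tens (e c) b + tens c (f b).
Proof. exact/tlift_tens/tensor_der_balanced. Qed.

Lemma tensor_der_nmod_morphism : nmod_morphism tensor_der_fun.
Proof.
split=> [|x y]; first exact/tlift0/tensor_der_balanced.
exact/tliftD/tensor_der_balanced.
Qed.

HB.instance Definition _ := GRing.isNmodMorphism.Build
  (tensor C B) (tensor C B) tensor_der_fun tensor_der_nmod_morphism.

Lemma tensor_derM (x y : tensor C B) :
  tensor_der_fun (x * y) = tensor_der_fun x * y + x * tensor_der_fun y.
Proof.
elim/tensor_ind: x => [|c b x IHx]; first by rewrite !(mul0r, raddf0) addr0.
rewrite mulrDl !raddfD/= !mulrDl {}IHx [RHS]addrACA; congr (_ + _).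
elim/tensor_ind: y => [|c' b' y IHy]; first by rewrite !(mulr0, raddf0) addr0.
rewrite mulrDr !raddfD/= !mulrDr IHy [RHS]addrACA; congr (_ + _).
rewrite tensME !tensor_der_tens !mulrDl !mulrDr !tensME !derM tensDl tensDr.
by rewrite addrACA.
Qed.

Definition tensor_der : derivation (tensor C B) :=
  @MkDerivation (tensor C B) tensor_der_fun tensor_derM.

End TensorDerivation.

Section DiffBaseChange.
Variables (A : comPzRingType) (I : Type) (d : I -> derivation A).
Variable B : diff_algebra d.

Definition base_change_der (C : diff_algebra d) (i : I) :
    derivation (base_change B C) :=
  tensor_der (diff_algP C i) (diff_algP B i).

Lemma base_change_der_alg (C : diff_algebra d) (i : I) :
  differential (diff_der B i) (base_change_der C i)
    (alg_map (base_change B C)).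
Proof.
move=> b; rewrite [LHS](tensor_der_tens (diff_algP C i) (diff_algP B i)).
by rewrite der1 tens0l add0r.
Qed.

(* F^diff (C, eta) = (C (x)_A B, eta (x) delta) *)
Definition diff_base_change (C : diff_algebra d) :
    diff_algebra (diff_der B) :=
  @MkDiffAlgebra B I (diff_der B) (base_change B C) (base_change_der C)
    (@base_change_der_alg C).

Lemma base_change_map_diff (C C' : diff_algebra d) (phi : diff_hom C C') :
  @is_diff_hom B I (diff_der B) (diff_base_change C) (diff_base_change C')
    (base_change_map B phi).
Proof.
move=> i x; elim/tensor_ind: x => [|c b x IHx]; first by rewrite !raddf0.
rewrite !raddfD/=; congr (_ + _); last exact: IHx.
rewrite [in LHS]tensor_map_tens.
rewrite (tensor_der_tens (diff_algP C i) (diff_algP B i)).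
rewrite (tensor_der_tens (diff_algP C' i) (diff_algP B i)).
by rewrite raddfD/= !tensor_map_tens diff_homP.
Qed.

Definition diff_base_change_map (C C' : diff_algebra d)
    (phi : diff_hom C C') :
    diff_hom (diff_base_change C) (diff_base_change C') :=
  @MkDiffHom B I (diff_der B) (diff_base_change C) (diff_base_change C')
    (base_change_map B phi) (@base_change_map_diff C C' phi).

End DiffBaseChange.

Record category := MkCategory {
  obj :> Type;
  hom : obj -> obj -> Type;
  cat_id : forall X, hom X X;
  cat_comp : forall X Y Z, hom Y Z -> hom X Y -> hom X Z;
  cat_idl : forall X Y (f : hom X Y), cat_comp (cat_id Y) f = f;
  cat_idr : forall X Y (f : hom X Y), cat_comp f (cat_id X) = f;
  cat_compA : forall X Y Z T (h : hom Z T) (g : hom Y Z) (f : hom X Y),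
    cat_comp h (cat_comp g f) = cat_comp (cat_comp h g) f
}.

Record functor (X Y : category) := MkFunctor {
  fobj :> X -> Y;
  fmap : forall a b : X, hom a b -> hom (fobj a) (fobj b);
  fmap_id : forall a : X, fmap (cat_id a) = cat_id (fobj a);
  fmap_comp : forall (a b c : X) (g : hom b c) (f : hom a b),
    fmap (cat_comp g f) = cat_comp (fmap g) (fmap f)
}.

Definition left_adjoint (X Y : category) (L : functor Y X) (R : functor X Y) :
    Prop :=
  exists Phi : forall (y : Y) (x : X), hom (L y) x -> hom y (R x),
    [/\ forall y x, bijective (@Phi y x),
        forall y x x' (g : hom x x') (f : hom (L y) x),
          Phi y x' (cat_comp g f) = cat_comp (fmap R g) (Phi y x f)
      & forall y y' x (f : hom (L y) x) (h : hom y' y),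
          Phi y' x (cat_comp f (fmap L h)) = cat_comp (Phi y x f) h].

Section DiffCategory.
Variables (A : comPzRingType) (I : Type) (d : I -> derivation A).

Lemma diff_comp_idl (C D : diff_algebra d) (f : diff_hom C D) :
  diff_comp (diff_id D) f = f.
Proof. exact: diff_hom_eq. Qed.

Lemma diff_comp_idr (C D : diff_algebra d) (f : diff_hom C D) :
  diff_comp f (diff_id C) = f.
Proof. exact: diff_hom_eq. Qed.

Lemma diff_compA (C D E G : diff_algebra d) (h : diff_hom E G)
  (g : diff_hom D E) (f : diff_hom C D) :
  diff_comp h (diff_comp g f) = diff_comp (diff_comp h g) f.
Proof. exact: diff_hom_eq. Qed.

Definition diff_category : category :=
  MkCategory diff_comp_idl diff_comp_idr diff_compA.

End DiffCategory.

Section DiffBaseChangeFunctor.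
Variables (A : comPzRingType) (I : Type) (d : I -> derivation A).
Variable B : diff_algebra d.

Lemma diff_base_change_id (C : diff_algebra d) :
  diff_base_change_map B (diff_id C) = diff_id (diff_base_change B C).
Proof.
apply: diff_hom_eq => x; elim/tensor_ind: x => [|c b x IHx].
  by rewrite !raddf0.
by rewrite !raddfD /= [X in _ + X]IHx [X in X + _]tensor_map_tens.
Qed.

Lemma diff_base_change_comp (C D E : diff_algebra d)
  (g : diff_hom D E) (f : diff_hom C D) :
  diff_base_change_map B (diff_comp g f) =
  diff_comp (diff_base_change_map B g) (diff_base_change_map B f).
Proof.
apply: diff_hom_eq => x; elim/tensor_ind: x => [|c b x IHx].
  by rewrite !raddf0.
by rewrite !raddfD /= [X in _ + X]IHx !tensor_map_tens.
Qed.

Definition diff_base_change_functor :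
    functor (diff_category d) (diff_category (diff_der B)) :=
  @MkFunctor (diff_category d) (diff_category (diff_der B))
    (diff_base_change B) (@diff_base_change_map A I d B)
    diff_base_change_id diff_base_change_comp.

End DiffBaseChangeFunctor.

Definition weil_tau (A : comPzRingType) (B : algebra A) (D : algebra B)
    (WD C : algebra A) (u : alg_hom D (base_change B WD))
    (phi : alg_hom WD C) : alg_hom D (base_change B C) :=
  alg_comp (base_change_map B phi) u.

(* W is only determined up to unique isomorphism: an element of this type is a
   choice of all the W(D) together with the units W_D. *)
Record weil_descent (A : comPzRingType) (B : algebra A) := MkWeilDescent {
  weil_alg :> algebra B -> algebra A;
  weil_unit : forall D, alg_hom D (base_change B (weil_alg D));
  weil_tau_bij : forall D C, bijective (@weil_tau A B D _ C (weil_unit D))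
}.

(* g = W(f) *)
Definition is_weil_map (A : comPzRingType) (B : algebra A)
    (W : weil_descent B) (D D' : algebra B) (f : alg_hom D D')
    (g : alg_hom (W D) (W D')) : Prop :=
  alg_comp (base_change_map B g) (weil_unit W D) =
  alg_comp (weil_unit W D') f.

(* e = partial_i^W *)
Definition is_weil_der (A : comPzRingType) (I : Type) (d : I -> derivation A)
    (B : diff_algebra d) (W : weil_descent B) (D : diff_algebra (diff_der B))
    (i : I) (e : derivation (W D)) : Prop :=
  exists eP : differential (d i) e (alg_map (W D)),
    differential (diff_der D i) (tensor_der eP (diff_algP B i))
      (weil_unit W D).

(* W^diff (D, partial) = (W(D), partial^W) *)
Definition weil_diff (A : comPzRingType) (I : Type) (d : I -> derivation A)
    (B : diff_algebra d) (W : weil_descent B) (D : diff_algebra (diff_der B))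
    (dW : I -> derivation (W D))
    (dWP : forall i, is_weil_der i (dW i)) : diff_algebra d :=
  @MkDiffAlgebra A I d (W D) dW (fun i => let: ex_intro eP _ := dWP i in eP).

(* The sum over all k : I is a finite one, by the first condition. *)
Definition lie_commuting (A : comPzRingType) (I : choiceType) (R : algebra A)
    (del : I -> derivation R) (a : I -> I -> I -> A) : Prop :=
  (forall i j, finite_set [set k | a i j k != 0]%classic) /\
  (forall i j x, del i (del j x) - del j (del i x) =
    \sum_(k \in [set: I]) alg_map R (a i j k) * del k x).

(* Main.v *)
(* With a basis of B, C (x)_A B is C^l, so W(D) is generated over A by the
   coordinates of the elements of D, subject to every relation that holds in
   all A-algebras C.

   A derivation of W(D) extending d_i is an A-algebra map from W(D) to the dual
   numbers W(D)[eps], with A acting through a + d_i(a) eps, that lifts the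
   identity.  Since C[eps] (x)_A B is isomorphic to (C (x)_A B)[eps] by means of
   delta_i, the universal property turns such maps into B-algebra maps
   x |-> W_D(x) + W_D(partial_i x) eps.  This gives the existence of
   partial_i^W, and shows that an A-compatible derivation along a map
   phi : W(D) -> C is determined by its effect on the image of W_D; (ii) and
   then (i) follow.

   For (iii), put E = [partial_i^W, partial_j^W] - sum_k a_ij^k partial_k^W and
   let P and G be the same expressions in the derivations of W(D) (x)_A B and of
   B, so that P = E (x) 1 + 1 (x) G.  As W_D is differential, P vanishes on its
   image, which contains 1 (x) B; hence 1 (x) G = 0 and P = E (x) 1.  On the
   image of A this gives E(a) (x) 1 = 0, so E(a) = 0 as l >= 1.  Thus E is an
   A-linear derivation with (E (x) 1) o W_D = 0, whence E = 0. *)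
Require Import Defs.
From HB Require Import structures.
From mathcomp Require Import all_boot all_order all_algebra.
From mathcomp Require Import all_classical.
From mathcomp Require Import finmap ring.

Set Implicit Arguments.
Unset Strict Implicit.
Unset Printing Implicit Defensive.

Import GRing.Theory.
Local Open Scope quotient_scope.
Local Open Scope ring_scope.

(** * Additive maps on tensor products *)

Lemma nmod_morphism_of_add (U V : zmodType) (f : U -> V) :
  {morph f : x y / x + y} -> nmod_morphism f.
Proof. by move=> fD; split=> //; apply: (@addrI _ (f 0)); rewrite -fD !addr0. Qed.

Section TensorTheory.
Variables (A : comPzRingType) (C B : algebra A).

Lemma tensor_additive_ext (M : nmodType) (f g : tensor C B -> M) :
  nmod_morphism f -> nmod_morphism g ->
  (forall c b, f (tens c b) = g (tens c b)) -> f =1 g.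
Proof.
move=> [f0 fD] [g0 gD] fg; elim/tensor_ind => [|c b x IHx]; first by rewrite f0 g0.
by rewrite fD gD fg IHx.
Qed.

Lemma tlift_nmod_morphism (M : nmodType) (f : C -> B -> M) :
  balanced f -> nmod_morphism (tlift f).
Proof. by move=> fB; split=> [|x y]; [exact: tlift0 | exact: tliftD]. Qed.

Lemma tens0r (c : C) : tens c (0 : B) = 0.
Proof. by apply: (@addrI _ (tens c (0 : B))); rewrite -tensDr !addr0. Qed.

Lemma tensNl (c : C) (b : B) : tens (- c) b = - tens c b.
Proof. by apply: (@addrI _ (tens c b)); rewrite -tensDl !subrr tens0l. Qed.

Lemma tensNr (c : C) (b : B) : tens c (- b) = - tens c b.
Proof. by apply: (@addrI _ (tens c b)); rewrite -tensDr !subrr tens0r. Qed.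

End TensorTheory.

Lemma base_change_map_tens (A : comPzRingType) (B C C' : algebra A)
  (phi : alg_hom C C') (c : C) (b : B) :
  base_change_map B phi (tens c b) = tens (phi c) b.
Proof. exact: tensor_map_tens. Qed.

(** * Coordinates in a basis of B, and in C (x)_A B *)

Section Coordinates.
Variables (A : comPzRingType) (B : algebra A) (l : nat) (e : 'I_l -> B).
Hypothesis e_basis : forall b : B,
  exists! c : {ffun 'I_l -> A}, b = \sum_j alg_map B (c j) * e j.

Definition bcoord (b : B) : {ffun 'I_l -> A} := sval (cid (e_basis b)).

Lemma bcoordE (b : B) : b = \sum_j alg_map B (bcoord b j) * e j.
Proof. by rewrite /bcoord; case: cid => c /= []. Qed.

Lemma bcoord_unique (b : B) (c : {ffun 'I_l -> A}) :
  b = \sum_j alg_map B (c j) * e j -> bcoord b = c.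
Proof. by rewrite /bcoord; case: cid => c' /= [_ u]; exact: u. Qed.

Lemma bcoordD (b b' : B) k : bcoord (b + b') k = bcoord b k + bcoord b' k.
Proof.
rewrite (@bcoord_unique _ [ffun j => bcoord b j + bcoord b' j]) ?ffunE//.
rewrite {1}[b]bcoordE {1}[b']bcoordE -big_split; apply: eq_bigr => j _.
by rewrite ffunE rmorphD mulrDl.
Qed.

Lemma bcoordZ (a : A) (b : B) k : bcoord (alg_map B a * b) k = a * bcoord b k.
Proof.
rewrite (@bcoord_unique _ [ffun j => a * bcoord b j]) ?ffunE//.
rewrite {1}[b]bcoordE mulr_sumr; apply: eq_bigr => j _.
by rewrite ffunE rmorphM mulrA.
Qed.

Lemma bcoord_basis k : bcoord (e k) k = 1.
Proof.
rewrite (@bcoord_unique _ [ffun j => (j == k)%:R]) ?ffunE ?eqxx//.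
rewrite (bigD1 k)//= ffunE eqxx rmorph1 mul1r big1 ?addr0// => j /negPf jk.
by rewrite ffunE jk rmorph0 mul0r.
Qed.

Variable C : algebra A.

(** The k-th projection under the identification of C (x)_A B with C^l given by the basis [e]. *)
Definition tcoord (k : 'I_l) : tensor C B -> C :=
  tlift (fun c b => alg_map C (bcoord b k) * c).

Lemma tcoord_balanced k :
  balanced (fun (c : C) (b : B) => alg_map C (bcoord b k) * c).
Proof.
split=> [b|c c' b|c b b'|a c b].
- by rewrite mulr0.
- by rewrite mulrDr.
- by rewrite bcoordD rmorphD mulrDl.
- by rewrite bcoordZ rmorphM mulrCA mulrA.
Qed.

Lemma tcoord_tens k (c : C) (b : B) :
  tcoord k (tens c b) = alg_map C (bcoord b k) * c.
Proof. exact/tlift_tens/tcoord_balanced. Qed.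

Lemma tcoord_nmod_morphism k : nmod_morphism (tcoord k).
Proof. exact/tlift_nmod_morphism/tcoord_balanced. Qed.

HB.instance Definition _ k := GRing.isNmodMorphism.Build
  (tensor C B) C (tcoord k) (tcoord_nmod_morphism k).

Lemma tcoordE (z : tensor C B) : z = \sum_k tens (tcoord k z) (e k).
Proof.
elim/tensor_ind: z => [|c b z IHz].
  by rewrite big1// => k _; rewrite raddf0 tens0l.
under [RHS]eq_bigr do rewrite raddfD tensDl.
rewrite big_split -IHz {IHz}; congr (_ + _).
under [RHS]eq_bigr do rewrite [X in tens X _]tcoord_tens tensZ.
rewrite {1}[b]bcoordE; elim/big_rec2: _ => [|k x y _ <-]; first exact: tens0r.
by rewrite tensDr.
Qed.

End Coordinates.

(** Coordinates are natural in C. This is what lets an identity in W(D) (x)_A B be tested after base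
    change along every evaluation. *)
Lemma tcoord_map (A : comPzRingType) (B : algebra A) (l : nat) (e : 'I_l -> B)
    (e_basis : forall b : B,
       exists! c : {ffun 'I_l -> A}, b = \sum_j alg_map B (c j) * e j)
    (C C' : algebra A) (phi : alg_hom C C') k (z : tensor C B) :
  tcoord e_basis k (base_change_map B phi z) = phi (tcoord e_basis k z).
Proof.
move: z; apply: (@tensor_additive_ext _ _ _ _ (tcoord e_basis k \o _) (phi \o _)).
- by split=> [|x y] /=; rewrite ?raddf0 ?raddfD.
- by split=> [|x y] /=; rewrite ?raddf0 ?raddfD.
- move=> c b /=; rewrite [X in tcoord _ _ X]tensor_map_tens !tcoord_tens.
  by rewrite rmorphM alg_hom_map.
Qed.

(* W(D): the A-algebra terms in the symbols x_k (x in D, k < l), modulo the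
   identities that hold in every A-algebra C once x_k is read as the k-th
   bcoordinate of psi x, for every B-algebra map psi : D -> C (x)_A B.  The
   quantifier over C is impredicative. *)
Section WeilAlgebra.
Variables (A : comPzRingType) (B : algebra A) (l : nat) (e : 'I_l -> B).
Hypothesis e_basis : forall b : B,
  exists! c : {ffun 'I_l -> A}, b = \sum_j alg_map B (c j) * e j.
Variable D : algebra B.

Inductive weil_term :=
| WVar (x : D) (k : 'I_l)
| WCst (a : A)
| WAdd (s t : weil_term)
| WOpp (t : weil_term)
| WMul (s t : weil_term).

HB.instance Definition _ := gen_eqMixin weil_term.
HB.instance Definition _ := gen_choiceMixin weil_term.

Section Eval.
Variables (C : algebra A) (psi : alg_hom D (base_change B C)).

Fixpoint weil_eval (t : weil_term) : C :=
  match t with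
  | WVar x k => tcoord e_basis k (psi x)
  | WCst a => alg_map C a
  | WAdd s t => weil_eval s + weil_eval t
  | WOpp t => - weil_eval t
  | WMul s t => weil_eval s * weil_eval t
  end.

End Eval.

Definition weil_rel (s t : weil_term) : bool :=
  `[< forall C psi, @weil_eval C psi s = weil_eval psi t >].

Lemma weil_rel_equiv : equiv_class_of weil_rel.
Proof.
split=> [s|s t|t s u]; first exact/asboolP.
- by apply/asboolP/asboolP => st C psi; rewrite st.
- by move=> /asboolP st /asboolP tu; apply/asboolP => C psi; rewrite st tu.
Qed.

Canonical weil_equiv := EquivRelPack weil_rel_equiv.

Definition weil_ring := {eq_quot weil_equiv}.
HB.instance Definition _ := Choice.on weil_ring.
HB.instance Definition _ := EqQuotient.on weil_ring.

Definition weil_ev (C : algebra A) (psi : alg_hom D (base_change B C))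
  (x : weil_ring) : C := weil_eval psi (repr x).

Lemma weil_ev_pi (C : algebra A) (psi : alg_hom D (base_change B C)) t :
  weil_ev psi (\pi_weil_ring t) = weil_eval psi t.
Proof.
rewrite /weil_ev.
have /eqquotP/asboolP h := reprK (\pi_weil_ring t); exact: h.
Qed.

(** Evaluations jointly separate W(D), by the choice of [weil_rel]. Each ring law of W(D) thus
    reduces to the same law in every C. *)
Lemma weil_ev_inj (x y : weil_ring) :
  (forall C psi, @weil_ev C psi x = weil_ev psi y) -> x = y.
Proof.
move=> xy; rewrite -[x]reprK -[y]reprK; apply/eqquotP/asboolP => C psi.
exact: xy.
Qed.

Definition weil0 := \pi_weil_ring (WCst 0).
Definition weil1 := \pi_weil_ring (WCst 1).
Definition weilD (x y : weil_ring) := \pi_weil_ring (WAdd (repr x) (repr y)).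
Definition weilN (x : weil_ring) := \pi_weil_ring (WOpp (repr x)).
Definition weilM (x y : weil_ring) := \pi_weil_ring (WMul (repr x) (repr y)).

Section EvalOps.
Variables (C : algebra A) (psi : alg_hom D (base_change B C)).

Lemma weil_ev0 : weil_ev psi weil0 = 0.
Proof. by rewrite weil_ev_pi /= rmorph0. Qed.

Lemma weil_ev1 : weil_ev psi weil1 = 1.
Proof. by rewrite weil_ev_pi /= rmorph1. Qed.

Lemma weil_evD x y : weil_ev psi (weilD x y) = weil_ev psi x + weil_ev psi y.
Proof. by rewrite weil_ev_pi. Qed.

Lemma weil_evN x : weil_ev psi (weilN x) = - weil_ev psi x.
Proof. by rewrite weil_ev_pi. Qed.

Lemma weil_evM x y : weil_ev psi (weilM x y) = weil_ev psi x * weil_ev psi y.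
Proof. by rewrite weil_ev_pi. Qed.

End EvalOps.

Let weil_evE := (weil_ev0, weil_ev1, weil_evD, weil_evN, weil_evM).

Lemma weilDA : associative weilD.
Proof. by move=> x y z; apply: weil_ev_inj => C psi; rewrite !weil_evE addrA. Qed.

Lemma weilDC : commutative weilD.
Proof. by move=> x y; apply: weil_ev_inj => C psi; rewrite !weil_evE addrC. Qed.

Lemma weil0D : left_id weil0 weilD.
Proof. by move=> x; apply: weil_ev_inj => C psi; rewrite !weil_evE add0r. Qed.

Lemma weilND : left_inverse weil0 weilN weilD.
Proof. by move=> x; apply: weil_ev_inj => C psi; rewrite !weil_evE addNr. Qed.

Lemma weilMA : associative weilM.
Proof. by move=> x y z; apply: weil_ev_inj => C psi; rewrite !weil_evE mulrA. Qed.

Lemma weilMC : commutative weilM.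
Proof. by move=> x y; apply: weil_ev_inj => C psi; rewrite !weil_evE mulrC. Qed.

Lemma weil1M : left_id weil1 weilM.
Proof. by move=> x; apply: weil_ev_inj => C psi; rewrite !weil_evE mul1r. Qed.

Lemma weilMDl : left_distributive weilM weilD.
Proof. by move=> x y z; apply: weil_ev_inj => C psi; rewrite !weil_evE mulrDl. Qed.

HB.instance Definition _ := GRing.isZmodule.Build weil_ring weilDA weilDC weil0D weilND.
HB.instance Definition _ := GRing.Zmodule_isComPzRing.Build weil_ring
  weilMA weilMC weil1M weilMDl.

Definition weil_cst (a : A) : weil_ring := \pi_weil_ring (WCst a).

Lemma weil_cst_nmod_morphism : nmod_morphism weil_cst.
Proof.
split=> // x y; apply: weil_ev_inj => C psi.
by rewrite [RHS]weil_evD !weil_ev_pi /= rmorphD.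
Qed.

Lemma weil_cst_monoid_morphism : monoid_morphism weil_cst.
Proof.
split=> // x y; apply: weil_ev_inj => C psi.
by rewrite [RHS]weil_evM !weil_ev_pi /= rmorphM.
Qed.

HB.instance Definition _ :=
  GRing.isNmodMorphism.Build A weil_ring weil_cst weil_cst_nmod_morphism.
HB.instance Definition _ :=
  GRing.isMonoidMorphism.Build A weil_ring weil_cst weil_cst_monoid_morphism.

Definition weil_algebra : algebra A := @MkAlgebra A weil_ring weil_cst.

Section EvalHom.
Variables (C : algebra A) (psi : alg_hom D (base_change B C)).

Lemma weil_ev_nmod_morphism : nmod_morphism (weil_ev psi).
Proof. by split=> [|x y]; [exact: weil_ev0 | exact: weil_evD]. Qed.

Lemma weil_ev_monoid_morphism : monoid_morphism (weil_ev psi).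
Proof. by split=> [|x y]; [exact: weil_ev1 | exact: weil_evM]. Qed.

HB.instance Definition _ :=
  GRing.isNmodMorphism.Build weil_ring C (weil_ev psi) weil_ev_nmod_morphism.
HB.instance Definition _ :=
  GRing.isMonoidMorphism.Build weil_ring C (weil_ev psi) weil_ev_monoid_morphism.

Lemma weil_ev_cst a : weil_ev psi (alg_map weil_algebra a) = alg_map C a.
Proof. by rewrite [LHS]weil_ev_pi. Qed.

Definition weil_ev_hom : alg_hom weil_algebra C :=
  @MkAlgHom A weil_algebra C (weil_ev psi) weil_ev_cst.

End EvalHom.

(** The unit W_D: the generic point, whose k-th coordinate is the symbol x_k. It specialises to
    every psi by [weil_ev_univ]. *)
Definition weil_univ (x : D) : tensor weil_algebra B :=
  \sum_k tens (\pi_weil_ring (WVar x k) : weil_algebra) (e k).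

Lemma weil_ev_univ (C : algebra A) (psi : alg_hom D (base_change B C)) x :
  base_change_map B (weil_ev_hom psi) (weil_univ x) = psi x.
Proof.
rewrite [RHS](tcoordE e_basis) raddf_sum; apply: eq_bigr => k _.
by rewrite [LHS]tensor_map_tens [X in tens X _]weil_ev_pi.
Qed.

(** Evaluations separate each coordinate, hence W(D) (x)_A B. So [weil_univ] is a B-algebra map
    because all its specialisations psi are. *)
Lemma weil_base_change_inj (z z' : tensor weil_algebra B) :
  (forall C (psi : alg_hom D (base_change B C)),
     base_change_map B (weil_ev_hom psi) z = base_change_map B (weil_ev_hom psi) z')
  -> z = z'.
Proof.
move=> zz'; rewrite (tcoordE e_basis z) (tcoordE e_basis z').
apply: eq_bigr => k _; congr tens; apply: weil_ev_inj => C psi.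
have /(congr1 (tcoord e_basis k)) := zz' C psi.
by rewrite !tcoord_map.
Qed.

Lemma weil_univ_nmod_morphism : nmod_morphism weil_univ.
Proof.
apply: nmod_morphism_of_add => x y; apply: weil_base_change_inj => C psi.
rewrite weil_ev_univ [RHS]raddfD raddfD.
by congr (_ + _); exact/esym/weil_ev_univ.
Qed.

Lemma weil_univ_monoid_morphism : monoid_morphism weil_univ.
Proof.
split=> [|x y]; apply: weil_base_change_inj => C psi.
  by rewrite [RHS]rmorph1 weil_ev_univ rmorph1.
rewrite weil_ev_univ [RHS]rmorphM rmorphM.
by congr (_ * _); exact/esym/weil_ev_univ.
Qed.

HB.instance Definition _ := GRing.isNmodMorphism.Build
  D (tensor weil_algebra B) weil_univ weil_univ_nmod_morphism.
HB.instance Definition _ := GRing.isMonoidMorphism.Build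
  D (tensor weil_algebra B) weil_univ weil_univ_monoid_morphism.

Lemma weil_univ_alg (b : B) :
  weil_univ (alg_map D b) = alg_map (base_change B weil_algebra) b.
Proof.
apply: weil_base_change_inj => C psi.
by rewrite weil_ev_univ !alg_hom_map.
Qed.

Definition weil_univ_hom : alg_hom D (base_change B weil_algebra) :=
  @MkAlgHom B D (base_change B weil_algebra) weil_univ weil_univ_alg.

Lemma weil_univ_bij (C : algebra A) :
  bijective (@weil_tau A B D weil_algebra C weil_univ_hom).
Proof.
exists (@weil_ev_hom C) => [phi|psi]; last first.
  by apply: alg_hom_eq => x /=; rewrite [LHS]weil_ev_univ.
(* The k-th coordinate of [weil_univ x] is the class of x_k, as every evaluation shows; naturality
   of coordinates then lets tau(phi) determine phi on the symbols. *)
have var x k : tcoord e_basis k (weil_tau weil_univ_hom phi x) =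
    phi (\pi_weil_ring (WVar x k)).
  rewrite /= [LHS]tcoord_map; congr (phi _); apply: weil_ev_inj => C' psi.
  have := tcoord_map e_basis (weil_ev_hom psi) k (weil_univ x).
  by rewrite weil_ev_univ => /esym ->; rewrite weil_ev_pi.
apply: alg_hom_eq => z; rewrite -[z]reprK [LHS]weil_ev_pi.
have piD s t : \pi_weil_ring (WAdd s t) = \pi_weil_ring s + \pi_weil_ring t.
  by apply: weil_ev_inj => C' psi; rewrite [RHS]weil_evD !weil_ev_pi.
have piM s t : \pi_weil_ring (WMul s t) = \pi_weil_ring s * \pi_weil_ring t.
  by apply: weil_ev_inj => C' psi; rewrite [RHS]weil_evM !weil_ev_pi.
have piN t : \pi_weil_ring (WOpp t) = - \pi_weil_ring t.
  by apply: weil_ev_inj => C' psi; rewrite [RHS]weil_evN !weil_ev_pi.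
(* Evaluation at tau(phi) and phi itself agree on the symbols and on A, hence on all terms. *)
elim: (repr z) => [x k|a|s IHs t IHt|t IHt|s IHs t IHt] //=.
- exact: var.
- by rewrite -(alg_hom_map phi).
- by rewrite IHs IHt piD rmorphD.
- by rewrite IHt piN rmorphN.
- by rewrite IHs IHt piM rmorphM.
Qed.

End WeilAlgebra.

Lemma weil_descent_exists (A : comPzRingType) (B : algebra A) l :
  free_of_rank B l -> inhabited (weil_descent B).
Proof.
move=> [e e_basis].
exact: inhabits (MkWeilDescent (@weil_univ_bij A B l e e_basis)).
Qed.

(** * Dual numbers *)

(* The pair (x, y) stands for x + y eps, with eps^2 = 0. *)
Definition dual (R : comPzRingType) : Type := (R * R)%type.

Section DualRing.
Variable R : comPzRingType.

HB.instance Definition _ := GRing.Zmodule.on (dual R).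

Definition dualM (x y : dual R) : dual R := (x.1 * y.1, x.1 * y.2 + x.2 * y.1).

Lemma dualMA : associative dualM.
Proof.
by move=> x y z; rewrite /dualM /= mulrDr mulrDl !mulrA addrA.
Qed.

Lemma dualMC : commutative dualM.
Proof.
move=> x y; rewrite /dualM (mulrC y.1 x.1) addrC.
by rewrite (mulrC y.1) (mulrC y.2).
Qed.

Lemma dual1M : left_id ((1, 0) : dual R) dualM.
Proof. by case=> x y; rewrite /dualM /= !mul1r mul0r addr0. Qed.

Lemma dualMDl : left_distributive dualM +%R.
Proof. by move=> x y z; rewrite /dualM /= !mulrDl addrACA. Qed.

HB.instance Definition _ := GRing.Zmodule_isComPzRing.Build (dual R)
  dualMA dualMC dual1M dualMDl.

End DualRing.

(* C[eps], where A acts through a |-> a + d a eps. *)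
Section DualAlgebra.
Variables (A : comPzRingType) (d : derivation A) (C : algebra A).

Definition dual_map (a : A) : dual C := (alg_map C a, alg_map C (d a)).

Lemma dual_map_nmod_morphism : nmod_morphism dual_map.
Proof.
by apply: nmod_morphism_of_add => x y; rewrite /dual_map !raddfD.
Qed.

Lemma dual_map_monoid_morphism : monoid_morphism dual_map.
Proof.
split=> [|x y]; first by rewrite /dual_map der1 rmorph1 rmorph0.
by rewrite /dual_map derM rmorphD !rmorphM addrC.
Qed.

HB.instance Definition _ :=
  GRing.isNmodMorphism.Build A (dual C) dual_map dual_map_nmod_morphism.
HB.instance Definition _ :=
  GRing.isMonoidMorphism.Build A (dual C) dual_map dual_map_monoid_morphism.

Definition dual_alg : algebra A := @MkAlgebra A (dual C) dual_map.

Definition dual_cst (c : C) : dual_alg := (c, 0).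
Definition dual_eps (c : C) : dual_alg := (0, c).

Lemma dual_cstD c c' : dual_cst (c + c') = dual_cst c + dual_cst c'.
Proof. by congr pair; rewrite addr0. Qed.

Lemma dual_epsD c c' : dual_eps (c + c') = dual_eps c + dual_eps c'.
Proof. by congr pair; rewrite addr0. Qed.

Lemma dual_split c c' : ((c, c') : dual_alg) = dual_cst c + dual_eps c'.
Proof. by congr pair; rewrite ?addr0 ?add0r. Qed.

Lemma dual_cstM c c' : dual_cst c * dual_cst c' = dual_cst (c * c').
Proof. by congr pair; rewrite /= mulr0 mul0r addr0. Qed.

Lemma dual_cst_eps c c' : dual_cst c * dual_eps c' = dual_eps (c * c').
Proof. by congr pair; rewrite /= !(mulr0, mul0r, addr0). Qed.

Lemma dual_epsM c c' : dual_eps c * dual_eps c' = 0.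
Proof. by congr pair; rewrite /= !(mulr0, mul0r, addr0). Qed.

Lemma dual_mapE a :
  alg_map dual_alg a = dual_cst (alg_map C a) + dual_eps (alg_map C (d a)).
Proof. exact: dual_split. Qed.

Lemma dual_map_eps a c :
  alg_map dual_alg a * dual_eps c = dual_eps (alg_map C a * c).
Proof. by rewrite dual_mapE mulrDl dual_cst_eps dual_epsM addr0. Qed.

(** The twisted action of A need not preserve the constants of C[eps]: it adds d(a) c eps. The
    correction term of [dual_in0] absorbs this. *)
Lemma dual_map_cst a c : alg_map dual_alg a * dual_cst c =
  dual_cst (alg_map C a * c) + dual_eps (alg_map C (d a) * c).
Proof.
rewrite dual_mapE mulrDl dual_cstM; congr (_ + _).
by rewrite mulrC dual_cst_eps mulrC.
Qed.

Lemma dual_eps0 : dual_eps 0 = 0.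
Proof. by []. Qed.

Lemma dual_cst0 : dual_cst 0 = 0.
Proof. by []. Qed.

Definition dual_fst_fun (x : dual C) : C := x.1.

Lemma dual_fst_nmod_morphism : nmod_morphism dual_fst_fun.
Proof. by []. Qed.

Lemma dual_fst_monoid_morphism : monoid_morphism dual_fst_fun.
Proof. by []. Qed.

HB.instance Definition _ :=
  GRing.isNmodMorphism.Build (dual C) C dual_fst_fun dual_fst_nmod_morphism.
HB.instance Definition _ :=
  GRing.isMonoidMorphism.Build (dual C) C dual_fst_fun dual_fst_monoid_morphism.

Definition dual_fst : alg_hom dual_alg C :=
  @MkAlgHom A dual_alg C dual_fst_fun (fun=> erefl).

End DualAlgebra.

(* (C (x)_A B)[eps] -> C[eps] (x)_A B, u + v eps |-> dual_in0 u + dual_in1 v,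
   is the ring isomorphism inverse to
   (c + c' eps) (x) b |-> c (x) b + (c' (x) b + c (x) delta b) eps. *)
Section DualTensor.
Variables (A : comPzRingType) (B C : algebra A).
Variables (d : derivation A) (delta : derivation B).
Hypothesis deltaP : differential d delta (alg_map B).

Local Notation CE := (dual_alg d C).

Definition dual_in0 : tensor C B -> tensor CE B :=
  tlift (fun c b => tens (dual_cst d c) b - tens (dual_eps d c) (delta b)).

Definition dual_in1 : tensor C B -> tensor CE B :=
  tlift (fun c b => tens (dual_eps d c) b).

(** Moving a across the tensor sign produces eps d(a) c (x) b from the twisted action and, with a
    minus sign, the same term from the Leibniz rule for [delta]; [deltaP] makes them cancel. *)
Lemma dual_in0_balanced :
  balanced (fun (c : C) (b : B) =>
    tens (dual_cst d c) b - tens (dual_eps d c) (delta b)).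
Proof.
split=> [b|c c' b|c b b'|a c b].
- by rewrite dual_cst0 dual_eps0 !tens0l subr0.
- by rewrite dual_cstD dual_epsD !tensDl opprD addrACA.
- by rewrite raddfD !tensDr opprD addrACA.
- rewrite derM deltaP tensDr -!tensZ dual_map_cst !dual_map_eps tensDl.
  by rewrite opprD addrA addrK.
Qed.

Lemma dual_in1_balanced :
  balanced (fun (c : C) (b : B) => tens (dual_eps d c) b).
Proof.
split=> [b|c c' b|c b b'|a c b].
- by rewrite dual_eps0 tens0l.
- by rewrite dual_epsD tensDl.
- by rewrite tensDr.
- by rewrite -tensZ dual_map_eps.
Qed.

Lemma dual_in0_tens c b :
  dual_in0 (tens c b) = tens (dual_cst d c) b - tens (dual_eps d c) (delta b).
Proof. exact/tlift_tens/dual_in0_balanced. Qed.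

Lemma dual_in1_tens c b : dual_in1 (tens c b) = tens (dual_eps d c) b.
Proof. exact/tlift_tens/dual_in1_balanced. Qed.

Lemma dual_in0_nmod_morphism : nmod_morphism dual_in0.
Proof. exact/tlift_nmod_morphism/dual_in0_balanced. Qed.

Lemma dual_in1_nmod_morphism : nmod_morphism dual_in1.
Proof. exact/tlift_nmod_morphism/dual_in1_balanced. Qed.

HB.instance Definition _ := GRing.isNmodMorphism.Build
  (tensor C B) (tensor CE B) dual_in0 dual_in0_nmod_morphism.
HB.instance Definition _ := GRing.isNmodMorphism.Build
  (tensor C B) (tensor CE B) dual_in1 dual_in1_nmod_morphism.

(** Together with [dual_in1M] and [dual_in1_mul_in1], this is the multiplication table of (C (x)_A
    B)[eps]. The two mixed products of pure tensors are the two Leibniz terms for [delta]. *)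
Lemma dual_in0M u v : dual_in0 (u * v) = dual_in0 u * dual_in0 v.
Proof.
elim/tensor_ind: u => [|c b u IHu]; first by rewrite !(mul0r, raddf0).
rewrite mulrDl !raddfD/= mulrDl {}IHu; congr (_ + _).
elim/tensor_ind: v => [|c' b' v IHv]; first by rewrite !(mulr0, raddf0).
rewrite mulrDr !raddfD/= mulrDr {}IHv; congr (_ + _).
rewrite tensME !dual_in0_tens mulrBl !mulrBr !tensME.
rewrite dual_cstM dual_cst_eps dual_epsM tens0l subr0.
rewrite [dual_eps d c * _]mulrC dual_cst_eps derM tensDr (mulrC c').
by rewrite opprD addrA addrAC.
Qed.

Lemma dual_in1M u v : dual_in1 (u * v) = dual_in0 u * dual_in1 v.
Proof.
elim/tensor_ind: u => [|c b u IHu]; first by rewrite !(mul0r, raddf0).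
rewrite mulrDl !raddfD/= mulrDl {}IHu; congr (_ + _).
elim/tensor_ind: v => [|c' b' v IHv]; first by rewrite !(mulr0, raddf0).
rewrite mulrDr !raddfD/= mulrDr {}IHv; congr (_ + _).
rewrite tensME dual_in0_tens !dual_in1_tens mulrBl !tensME.
by rewrite dual_cst_eps dual_epsM tens0l subr0.
Qed.

Lemma dual_in1_mul_in1 u v : dual_in1 u * dual_in1 v = 0.
Proof.
elim/tensor_ind: u => [|c b u IHu]; first by rewrite !(mul0r, raddf0).
rewrite raddfD/= mulrDl {}IHu addr0.
elim/tensor_ind: v => [|c' b' v IHv]; first by rewrite !(mulr0, raddf0).
by rewrite raddfD/= mulrDr {}IHv addr0 !dual_in1_tens tensME dual_epsM tens0l.
Qed.

Lemma dual_fst_in0 u : base_change_map B (dual_fst d C) (dual_in0 u) = u.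
Proof.
elim/tensor_ind: u => [|c b u IHu]; first by rewrite !raddf0.
rewrite !raddfD/= [X in _ + X]IHu; congr (_ + _).
by rewrite dual_in0_tens raddfB/= !tensor_map_tens /= tens0l subr0.
Qed.

Lemma dual_fst_in1 u : base_change_map B (dual_fst d C) (dual_in1 u) = 0.
Proof.
elim/tensor_ind: u => [|c b u IHu]; first by rewrite !raddf0.
rewrite !raddfD/= [X in _ + X]IHu addr0.
by rewrite dual_in1_tens tensor_map_tens /= tens0l.
Qed.

(** The eps-coefficient of the inverse isomorphism; the constant coefficient is
    [base_change_map B (dual_fst d C)]. *)
Definition dual_snd : tensor CE B -> tensor C B :=
  tlift (fun (c : CE) b => tens c.2 b + tens c.1 (delta b)).

Lemma dual_snd_balanced :
  balanced (fun (c : CE) (b : B) => tens (c.2 : C) b + tens (c.1 : C) (delta b)).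
Proof.
split=> [b|c c' b|c b b'|a c b].
- by rewrite !tens0l addr0.
- by rewrite !tensDl addrACA.
- by rewrite raddfD !tensDr addrACA.
- rewrite derM deltaP /= tensDl !tensDr -!tensZ.
  by rewrite addrA.
Qed.

Lemma dual_snd_tens (c : CE) b :
  dual_snd (tens c b) = tens (c.2 : C) b + tens (c.1 : C) (delta b).
Proof. exact/tlift_tens/dual_snd_balanced. Qed.

Lemma dual_snd_nmod_morphism : nmod_morphism dual_snd.
Proof. exact/tlift_nmod_morphism/dual_snd_balanced. Qed.

HB.instance Definition _ := GRing.isNmodMorphism.Build
  (tensor CE B) (tensor C B) dual_snd dual_snd_nmod_morphism.

Lemma dual_snd_in0 u : dual_snd (dual_in0 u) = 0.
Proof.
elim/tensor_ind: u => [|c b u IHu]; first by rewrite !raddf0.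
rewrite !raddfD/= {}IHu addr0 dual_in0_tens raddfB/= !dual_snd_tens /=.
by rewrite !tens0l addr0 add0r subrr.
Qed.

Lemma dual_snd_in1 u : dual_snd (dual_in1 u) = u.
Proof.
elim/tensor_ind: u => [|c b u IHu]; first by rewrite !raddf0.
by rewrite !raddfD/= {}IHu dual_in1_tens dual_snd_tens /= tens0l addr0.
Qed.

End DualTensor.

(** * Derivations along a homomorphism as maps to dual numbers *)

(** Stated for a bare function [e], to cover composites of [phi] with a derivation on either side as
    well as the defect of a Lie relation. *)
Definition der_along (A : comPzRingType) (d : derivation A) (W C : algebra A)
    (phi : alg_hom W C) (e : W -> C) : Prop :=
  [/\ {morph e : x y / x + y},
      forall x y, e (x * y) = e x * phi y + phi x * e y
    & forall a, e (alg_map W a) = alg_map C (d a)].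

Section DerAlong.
Variables (A : comPzRingType) (d : derivation A) (W C : algebra A).
Variables (phi : alg_hom W C) (e : W -> C).
Hypothesis eP : der_along d phi e.

Lemma der_along_nmod_morphism : nmod_morphism e.
Proof. by case: eP => eD _ _; exact: nmod_morphism_of_add. Qed.

Definition dual_hom_fun (w : W) : dual_alg d C := (phi w, e w).

Lemma dual_hom_nmod_morphism : nmod_morphism dual_hom_fun.
Proof.
case: eP => eD _ _; apply: nmod_morphism_of_add => x y.
by rewrite /dual_hom_fun rmorphD eD.
Qed.

Lemma dual_hom_monoid_morphism : monoid_morphism dual_hom_fun.
Proof.
case: eP => eD eM eA; split=> [|x y].
  by rewrite /dual_hom_fun -{2}(rmorph1 (alg_map W)) eA der1 rmorph1 rmorph0.
by rewrite /dual_hom_fun rmorphM eM addrC.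
Qed.

HB.instance Definition _ := GRing.isNmodMorphism.Build
  W (dual_alg d C) dual_hom_fun dual_hom_nmod_morphism.
HB.instance Definition _ := GRing.isMonoidMorphism.Build
  W (dual_alg d C) dual_hom_fun dual_hom_monoid_morphism.

Lemma dual_hom_alg a : dual_hom_fun (alg_map W a) = alg_map (dual_alg d C) a.
Proof. by case: eP => _ _ eA; rewrite /dual_hom_fun alg_hom_map eA. Qed.

Definition dual_hom : alg_hom W (dual_alg d C) :=
  @MkAlgHom A W (dual_alg d C) dual_hom_fun dual_hom_alg.

Variables (B : algebra A) (delta : derivation B).
Hypothesis deltaP : differential d delta (alg_map B).

(** The map e (x) 1 + phi (x) delta, a generalisation of [tensor_der_fun] from the identity to
    [phi]. *)
Definition tensor_along : tensor W B -> tensor C B :=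
  tlift (fun w b => tens (e w) b + tens (phi w) (delta b)).

Lemma tensor_along_balanced :
  balanced (fun w (b : B) => tens (e w) b + tens (phi w) (delta b)).
Proof.
case: der_along_nmod_morphism => e0 eD; case: eP => _ eM eA.
split=> [b|c c' b|c b b'|a c b].
- by rewrite e0 rmorph0 !tens0l addr0.
- by rewrite eD rmorphD !tensDl addrACA.
- by rewrite raddfD !tensDr addrACA.
- rewrite eM eA rmorphM alg_hom_map derM deltaP tensDl tensDr -!tensZ.
  by rewrite addrA [X in X + _]addrC -addrA addrCA addrA.
Qed.

Lemma tensor_along_tens w (b : B) :
  tensor_along (tens w b) = tens (e w) b + tens (phi w) (delta b).
Proof. exact/tlift_tens/tensor_along_balanced. Qed.

Lemma tensor_along_nmod_morphism : nmod_morphism tensor_along.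
Proof. exact/tlift_nmod_morphism/tensor_along_balanced. Qed.

(** Through (C (x)_A B)[eps], the base change of phi + e eps is (phi (x) 1) + (e (x) 1 + phi (x)
    delta) eps. Hence tau sees a derivation along [phi] through [tensor_along] on the image of
    W_D. *)
Lemma base_change_dual_hom (z : tensor W B) :
  base_change_map B dual_hom z =
  dual_in0 d delta (base_change_map B phi z) + dual_in1 d (tensor_along z).
Proof.
have [_ i0D] := dual_in0_nmod_morphism C deltaP.
have [_ i1D] := @dual_in1_nmod_morphism A B C d.
have [t0 tD] := tensor_along_nmod_morphism.
elim/tensor_ind: z => [|w b z IHz]; first by rewrite t0 !raddf0 ?addr0.
rewrite tD !(rmorphD (base_change_map B _)) i0D i1D addrACA -IHz; congr (_ + _).
rewrite tensor_along_tens !base_change_map_tens i1D dual_in0_tens// !dual_in1_tens.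
(* The correction in [dual_in0] cancels the phi (x) delta part of [tensor_along]. *)
by rewrite (addrC (tens (dual_eps d _) b)) addrA addrNK -tensDl -dual_split.
Qed.

End DerAlong.

(** * Existence and uniqueness of the induced derivation *)

Section WeilDerivation.
Variables (A : comPzRingType) (B : algebra A) (W : weil_descent B).
Variables (d : derivation A) (delta : derivation B).
Hypothesis deltaP : differential d delta (alg_map B).

(** The maps phi + e eps and phi + e' eps have the same image under tau, which is injective. This
    rigidity yields uniqueness of the induced derivation, the differential criterion for [phi], and
    the vanishing of the Lie defect. *)
Lemma der_along_weil_inj (D : algebra B) (C : algebra A) (phi : alg_hom (W D) C)
    (e e' : W D -> C) :
  der_along d phi e -> der_along d phi e' ->
  (forall x, tensor_along phi e delta (weil_unit W D x) =
             tensor_along phi e' delta (weil_unit W D x)) ->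
  e =1 e'.
Proof.
move=> eP eP' ee' w.
have /bij_inj /(_ (dual_hom eP) (dual_hom eP')) inj :=
  weil_tau_bij W D (dual_alg d C).
have : dual_hom eP = dual_hom eP'.
  apply: inj; apply: alg_hom_eq => x /=.
  by rewrite !(base_change_dual_hom _ deltaP) ee'.
by move=> /(congr1 (fun f : alg_hom (W D) (dual_alg d C) => (f w : dual C).2)).
Qed.

Variables (D : algebra B) (del : derivation D).
Hypothesis delP : differential delta del (alg_map D).

Local Notation WE := (dual_alg d (W D)).

Definition weil_dual_fun (x : D) : tensor WE B :=
  dual_in0 d delta (weil_unit W D x) + dual_in1 d (weil_unit W D (del x)).

Lemma weil_dual_nmod_morphism : nmod_morphism weil_dual_fun.
Proof.
have [_ i0D] := dual_in0_nmod_morphism (W D) deltaP.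
have [_ i1D] := @dual_in1_nmod_morphism A B (W D) d.
apply: nmod_morphism_of_add => x y.
by rewrite /weil_dual_fun (raddfD del) !(rmorphD (weil_unit W D)) i0D i1D addrACA.
Qed.

(** On the image of b, the term W_D(del b) eps becomes 1 (x) delta b in the eps part and cancels the
    correction in [dual_in0]. This is where [delP] enters. *)
Lemma weil_dual_alg (b : B) :
  weil_dual_fun (alg_map D b) = alg_map (base_change B WE) b.
Proof.
rewrite /weil_dual_fun delP !alg_hom_map dual_in0_tens// dual_in1_tens addrNK.
by [].
Qed.

Lemma weil_dual_monoid_morphism : monoid_morphism weil_dual_fun.
Proof.
have [_ i1D] := @dual_in1_nmod_morphism A B (W D) d.
split=> [|x y].
  by rewrite -(rmorph1 (alg_map D)) weil_dual_alg rmorph1.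
rewrite /weil_dual_fun derM (rmorphD (weil_unit W D)).
rewrite !(rmorphM (weil_unit W D)) (mulrC (weil_unit W D (del x))) i1D.
rewrite dual_in0M// !(dual_in1M deltaP) mulrDl !mulrDr dual_in1_mul_in1 addr0 -addrA.
by congr (_ + _); rewrite addrC (mulrC (dual_in1 _ _)).
Qed.

HB.instance Definition _ := GRing.isNmodMorphism.Build
  D (tensor WE B) weil_dual_fun weil_dual_nmod_morphism.
HB.instance Definition _ := GRing.isMonoidMorphism.Build
  D (tensor WE B) weil_dual_fun weil_dual_monoid_morphism.

Definition weil_dual : alg_hom D (base_change B WE) :=
  @MkAlgHom B D (base_change B WE) weil_dual_fun weil_dual_alg.

Lemma weil_derivation_exists : exists e : derivation (W D),
  exists eP : differential d e (alg_map (W D)),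
    differential del (tensor_der eP deltaP) (weil_unit W D).
Proof.
have [_ i0D] := dual_in0_nmod_morphism (W D) deltaP.
have [f _ fK] := weil_tau_bij W D WE; set phi := f weil_dual.
have phiE x : base_change_map B phi (weil_unit W D x) = weil_dual x.
  by have /(congr1 (fun h : alg_hom _ _ => h x)) := fK weil_dual.
(* The constant part of phi is the identity, since tau(D, W(D)) sends both to W_D. *)
have phi1 w : (phi w : dual (W D)).1 = w.
  suff /(congr1 (fun h : alg_hom _ _ => h w)) :
    alg_comp (dual_fst d (W D)) phi = alg_id (W D) by [].
  apply: (bij_inj (weil_tau_bij W D (W D))); apply: alg_hom_eq => x /=.
  transitivity (weil_unit W D x).
    have bc z : base_change_map B (alg_comp (dual_fst d (W D)) phi) z =
        base_change_map B (dual_fst d (W D)) (base_change_map B phi z).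
      elim/tensor_ind: z => [|c b z IHz]; first by rewrite !raddf0.
      by rewrite !raddfD /= [X in _ + X]IHz !tensor_map_tens.
    rewrite [LHS]bc phiE raddfD.
    rewrite [X in X + _](dual_fst_in0 deltaP).
    by rewrite [X in _ + X]dual_fst_in1 addr0.
  elim/tensor_ind: (weil_unit W D x : tensor _ _) => [|c b z IHz].
    by rewrite !raddf0.
  by rewrite raddfD /= -IHz tensor_map_tens.
(* With constant part the identity, multiplicativity of phi is the Leibniz rule for its
   eps-coefficient, and A-linearity says that [e] extends [d]. *)
pose e w := (phi w : dual (W D)).2.
have e_nmod : nmod_morphism e.
  by apply: nmod_morphism_of_add => x y; rewrite /e rmorphD.
pose eA := GRing.isNmodMorphism.Build _ _ e e_nmod.
pose ea : {additive W D -> W D} := HB.pack e eA.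
have eM x y : ea (x * y) = ea x * y + x * ea y.
  by rewrite /ea /= /e rmorphM /= !phi1 addrC.
have eP : differential d (MkDerivation eM) (alg_map (W D)).
  by move=> a; rewrite /= /e alg_hom_map.
exists (MkDerivation eM), eP => x.
(* The derivation e (x) delta is the eps-coefficient of the base change of phi. At W_D(x) this is,
   by the choice of phi, W_D(del x). *)
have sE z : tensor_der_fun (MkDerivation eM) delta z =
    dual_snd delta (base_change_map B phi z).
  have [_ sD] := dual_snd_nmod_morphism (W D) deltaP.
  have [t0 tD] := tensor_der_nmod_morphism eP deltaP.
  elim/tensor_ind: z => [|c b z IHz]; first by rewrite t0 !raddf0.
  rewrite tD raddfD/= sD -IHz (tensor_der_tens eP deltaP) tensor_map_tens.
  by rewrite dual_snd_tens// phi1.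
rewrite [LHS]sE phiE /= /weil_dual_fun.
have [_ ->] := dual_snd_nmod_morphism (W D) deltaP.
by rewrite dual_snd_in0// dual_snd_in1// add0r.
Qed.

End WeilDerivation.

(** * Differential Weil descent *)

Lemma derivation_eq (R : comPzRingType) (e e' : derivation R) : e =1 e' -> e = e'.
Proof.
case: e e' => [[f [[hf]]] fM] [[g [[hg]]] gM] /= /funext fg.
by subst g; rewrite (Prop_irrelevance hf hg) in fM *; rewrite (Prop_irrelevance fM gM).
Qed.

Section WeilDiff.
Variables (A : comPzRingType) (I : Type) (d : I -> derivation A).
Variables (B : diff_algebra d) (W : weil_descent B).

Lemma weil_der_along (D : diff_algebra (diff_der B)) i (e : derivation (W D)) :
  is_weil_der i e -> der_along (d i) (alg_id (W D)) e.
Proof. by case=> eP _; split; [exact: raddfD | exact: derM | exact: eP]. Qed.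

Lemma tensor_along_id (D : algebra B) i (e : derivation (W D)) :
  tensor_along (alg_id (W D)) e (diff_der B i) = tensor_der_fun e (diff_der B i).
Proof. by []. Qed.

Lemma is_weil_der_unit (D : diff_algebra (diff_der B)) i (e : derivation (W D)) x :
  is_weil_der i e ->
  tensor_der_fun e (diff_der B i) (weil_unit W D x) =
  weil_unit W D (diff_der D i x).
Proof. by case=> eP; exact. Qed.

Lemma is_weil_der_exists_unique (D : diff_algebra (diff_der B)) i :
  exists! e : derivation (W D), is_weil_der i e.
Proof.
have [e eP] :=
  weil_derivation_exists W (diff_algP B i) (diff_algP D i).
exists e; split=> // e' eP'; apply: derivation_eq.
apply: (der_along_weil_inj (diff_algP B i) (weil_der_along eP) (weil_der_along eP')).
by move=> x; rewrite !tensor_along_id !is_weil_der_unit.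
Qed.

Variable dW : forall D : diff_algebra (diff_der B), I -> derivation (W D).
Hypothesis dWP : forall (D : diff_algebra (diff_der B)) (i : I),
  is_weil_der i (dW D i).

Local Notation Wdiff D := (weil_diff (dWP D)).

Section Hom.
Variables (D : diff_algebra (diff_der B)) (C : diff_algebra d).
Variable phi : alg_hom (W D) C.

(** A map [phi] is differential when eta_i o phi and phi o dW_i coincide. Both are derivations along
    [phi], so the image of W_D decides. *)
Lemma comp_der_along i :
  der_along (d i) phi (fun w => diff_der C i (phi w)).
Proof.
split=> [x y|x y|a]; first by rewrite rmorphD raddfD.
- by rewrite rmorphM derM.
- by rewrite alg_hom_map; exact: diff_algP.
Qed.

Lemma der_along_comp i : der_along (d i) phi (fun w => phi (dW D i w)).
Proof.
have [eD eM eA] := weil_der_along (dWP D i).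
split=> [x y|x y|a]; first by rewrite eD rmorphD.
- by rewrite eM rmorphD !rmorphM.
- by rewrite eA alg_hom_map.
Qed.

Lemma tensor_comp_der_along i (z : tensor (W D) B) :
  tensor_along phi (fun w => diff_der C i (phi w)) (diff_der B i) z =
  base_change_der B C i (base_change_map B phi z).
Proof.
move: z; apply: tensor_additive_ext => [||w b].
- exact: (tensor_along_nmod_morphism (comp_der_along i) (diff_algP B i)).
- by split=> [|x y]; rewrite ?raddf0 // !raddfD.
- rewrite (tensor_along_tens (comp_der_along i) (diff_algP B i)).
  rewrite base_change_map_tens.
  by rewrite [RHS](tensor_der_tens (diff_algP C i) (diff_algP B i)).
Qed.

Lemma tensor_der_along_comp i (z : tensor (W D) B) :
  tensor_along phi (fun w => phi (dW D i w)) (diff_der B i) z =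
  base_change_map B phi (tensor_der_fun (dW D i) (diff_der B i) z).
Proof.
have [eP _] := dWP D i.
have [t0 tD] := tensor_der_nmod_morphism eP (diff_algP B i).
move: z; apply: tensor_additive_ext => [||w b].
- exact: (tensor_along_nmod_morphism (der_along_comp i) (diff_algP B i)).
- by split=> [|x y]; rewrite ?t0 ?tD ?raddf0 // raddfD.
- rewrite (tensor_along_tens (der_along_comp i) (diff_algP B i)).
  rewrite (tensor_der_tens eP (diff_algP B i)) rmorphD.
  by congr (_ + _); rewrite [RHS]base_change_map_tens.
Qed.

(** At W_D(x), the two composites tensored with delta_i become (eta_i (x) delta_i)(tau(phi)(x)) and
    tau(phi)(del_i x). The converse direction is [der_along_weil_inj]. *)
Lemma weil_tau_diffP :
  @is_diff_hom A I d (Wdiff D) C phi <->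
  @is_diff_hom B I (diff_der B) D (diff_base_change B C)
    (weil_tau (weil_unit W D) phi).
Proof.
split=> phiP i.
  move=> x; rewrite /= -(is_weil_der_unit x (dWP D i)) -tensor_der_along_comp.
  rewrite -(_ : (fun w => diff_der C i (phi w)) = fun w => phi (dW D i w)).
    by rewrite tensor_comp_der_along.
  by apply/funext => w; exact: phiP.
apply: (der_along_weil_inj (diff_algP B i) (comp_der_along i) (der_along_comp i)).
move=> x; rewrite tensor_comp_der_along tensor_der_along_comp.
by rewrite is_weil_der_unit//; exact: phiP.
Qed.

End Hom.

Lemma weil_tau_set_bij (C : diff_algebra d) (D : diff_algebra (diff_der B)) :
  set_bij [set phi | @is_diff_hom A I d (Wdiff D) C phi]%classic
    [set psi | @is_diff_hom B I (diff_der B) D (diff_base_change B C) psi]%classic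
    (@weil_tau A B D (W D) C (weil_unit W D)).
Proof.
split=> [phi /weil_tau_diffP //|phi phi' _ _|psi psiP].
  exact: (bij_inj (weil_tau_bij W D C)).
have [f _ fK] := weil_tau_bij W D C.
by exists (f psi) => //; apply/weil_tau_diffP; rewrite fK.
Qed.

(** * The functor W^diff and its adjunction *)

Definition weil_unit_diff (D : diff_algebra (diff_der B)) :
    diff_hom D (diff_base_change B (Wdiff D)) :=
  @MkDiffHom B I (diff_der B) D (diff_base_change B (Wdiff D)) (weil_unit W D)
    (fun i x => is_weil_der_unit x (dWP D i)).

Definition weil_tau_diff (D : diff_algebra (diff_der B)) (C : diff_algebra d)
    (phi : diff_hom (Wdiff D) C) : diff_hom D (diff_base_change B C) :=
  diff_comp (diff_base_change_map B phi) (weil_unit_diff D).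

Lemma weil_tau_diff_inj D C : injective (@weil_tau_diff D C).
Proof.
move=> phi phi' e; apply: diff_hom_eq.
suff -> : diff_hom_alg phi = phi' :> alg_hom _ _ by [].
by apply: (bij_inj (weil_tau_bij W D C)); exact: (congr1 (@diff_hom_alg _ _ _ _ _) e).
Qed.

Lemma weil_tau_diff_surj D C (psi : diff_hom D (diff_base_change B C)) :
  exists phi, weil_tau_diff phi = psi.
Proof.
have [_ _ /(_ psi (diff_homP psi)) [phi phiP e]] := weil_tau_set_bij C D.
by exists (@MkDiffHom A I d (Wdiff D) C phi phiP); apply: diff_hom_eq => x; rewrite -e.
Qed.

Definition weil_tau_diff_inv D C (psi : diff_hom D (diff_base_change B C)) :=
  sval (cid (weil_tau_diff_surj psi)).

Lemma weil_tau_diff_invK D C : cancel (@weil_tau_diff_inv D C) (@weil_tau_diff D C).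
Proof. by move=> psi; exact: svalP (cid (weil_tau_diff_surj psi)). Qed.

(** The transpose of W_D' o f. Its equation [weil_diff_mapE] is the one characterising W(f);
    functoriality follows from it by injectivity of [weil_tau_diff]. *)
Definition weil_diff_map (D D' : diff_algebra (diff_der B)) (f : diff_hom D D') :
    diff_hom (Wdiff D) (Wdiff D') :=
  weil_tau_diff_inv (diff_comp (weil_unit_diff D') f).

Lemma weil_diff_mapE D D' (f : diff_hom D D') :
  weil_tau_diff (weil_diff_map f) = diff_comp (weil_unit_diff D') f.
Proof. exact: weil_tau_diff_invK. Qed.

Lemma weil_tau_diff_comp D C C' (g : diff_hom C C') (f : diff_hom (Wdiff D) C) :
  weil_tau_diff (diff_comp g f) =
  diff_comp (diff_base_change_map B g) (weil_tau_diff f).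
Proof. by rewrite /weil_tau_diff diff_base_change_comp diff_compA. Qed.

Lemma weil_tau_diff_comp_map D D' C (f : diff_hom (Wdiff D) C) (h : diff_hom D' D) :
  weil_tau_diff (diff_comp f (weil_diff_map h)) = diff_comp (weil_tau_diff f) h.
Proof. by rewrite weil_tau_diff_comp weil_diff_mapE /weil_tau_diff diff_compA. Qed.

Lemma weil_diff_map_id D : weil_diff_map (diff_id D) = diff_id (Wdiff D).
Proof.
apply: weil_tau_diff_inj; rewrite weil_diff_mapE diff_comp_idr.
by rewrite /weil_tau_diff diff_base_change_id diff_comp_idl.
Qed.

Lemma weil_diff_map_comp D D' D'' (g : diff_hom D' D'') (f : diff_hom D D') :
  weil_diff_map (diff_comp g f) = diff_comp (weil_diff_map g) (weil_diff_map f).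
Proof.
apply: weil_tau_diff_inj.
by rewrite weil_tau_diff_comp_map !weil_diff_mapE diff_compA.
Qed.

Lemma weil_diff_left_adjoint :
  left_adjoint
    (@MkFunctor (diff_category (diff_der B)) (diff_category d)
       (fun D => Wdiff D) weil_diff_map weil_diff_map_id weil_diff_map_comp)
    (diff_base_change_functor B).
Proof.
exists weil_tau_diff; split=> [D C|D C C' g f|D D' C f h].
- exists (@weil_tau_diff_inv D C); last exact: weil_tau_diff_invK.
  by move=> phi; apply: weil_tau_diff_inj; rewrite weil_tau_diff_invK.
- exact: weil_tau_diff_comp.
- exact: weil_tau_diff_comp_map.
Qed.

End WeilDiff.

(** * Transfer of Lie relations to W(D) *)

(** The failure of one Lie relation. Summing over a list [s] gives the same finite sum in D, B, W(D)
    and W(D) (x)_A B. *)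
Definition lie_defect (A : comPzRingType) (I : Type) (R : algebra A)
    (del : I -> derivation R) (i j : I) (s : seq I) (c : I -> A) (x : R) : R :=
  del i (del j x) - del j (del i x) - \sum_(k <- s) alg_map R (c k) * del k x.

Section LieDefect.
Variables (A : comPzRingType) (I : Type) (i j : I) (s : seq I) (c : I -> A).

Lemma lie_defectD (R : algebra A) (del : I -> derivation R) :
  {morph lie_defect del i j s c : x y / x + y}.
Proof.
move=> x y; rewrite /lie_defect !raddfD/=.
under eq_bigr do rewrite raddfD mulrDr.
rewrite big_split /=; ring.
Qed.

Lemma lie_defectM (R : algebra A) (del : I -> derivation R) x y :
  lie_defect del i j s c (x * y) =
  lie_defect del i j s c x * y + x * lie_defect del i j s c y.
Proof.
rewrite /lie_defect.
under eq_bigr do rewrite derM mulrDr mulrA mulrCA.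
rewrite big_split -mulr_suml -mulr_sumr /= !derM !raddfD /= !derM.
ring.
Qed.

Lemma lie_defect1 (R : algebra A) (del : I -> derivation R) :
  lie_defect del i j s c 1 = 0.
Proof.
by apply: (@addrI _ (lie_defect del i j s c 1));
  rewrite addr0 -[in RHS](mulr1 1) lie_defectM mulr1 mul1r.
Qed.

Lemma lie_defect_map (R S : algebra A) (f : alg_hom R S)
    (del : I -> derivation R) (eps : I -> derivation S) :
  (forall k, differential (del k) (eps k) f) ->
  forall x, lie_defect eps i j s c (f x) = f (lie_defect del i j s c x).
Proof.
move=> fP x; rewrite /lie_defect !rmorphB !fP rmorph_sum.
by congr (_ - _); apply: eq_bigr => k _; rewrite rmorphM alg_hom_map fP.
Qed.

(** The mixed terms e_i x (x) f_j b and e_j x (x) f_i b cancel in the commutator, leaving E (x) 1 +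
    1 (x) G. *)
Lemma lie_defect_tens (d : I -> derivation A) (C B : algebra A)
    (e : I -> derivation C) (f : I -> derivation B)
    (eP : forall k, differential (d k) (e k) (alg_map C))
    (fP : forall k, differential (d k) (f k) (alg_map B)) x b :
  @lie_defect A I (restrict_scalars (base_change B C))
    (fun k => tensor_der (eP k) (fP k)) i j s c (tens x b) =
  tens (lie_defect e i j s c x) b + tens x (lie_defect f i j s c b).
Proof.
have Dt k y b' : tensor_der (eP k) (fP k) (tens y b') =
    tens (e k y) b' + tens y (f k b') by exact: tensor_der_tens.
rewrite /lie_defect.
have -> : \sum_(k <- s) alg_map (restrict_scalars (base_change B C)) (c k) *
      tensor_der (eP k) (fP k) (tens x b) =
    tens (\sum_(k <- s) alg_map C (c k) * e k x) b +
    tens x (\sum_(k <- s) alg_map B (c k) * f k b).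
  rewrite (big_morph (fun y => tens y b) (fun y z => tensDl y z b) (tens0l _ b)).
  rewrite (big_morph (tens x) (tensDr x) (tens0r B x)) -big_split.
  apply: eq_bigr => k _; rewrite Dt mulrDr.
  by rewrite !tensME !mul1r tensZ.
rewrite !Dt !raddfD /= !Dt !tensDl !tensDr !tensNl !tensNr.
ring.
Qed.

End LieDefect.

Lemma derivation0_subproof (R : comPzRingType) (x y : R) :
  (\0 : {additive R -> R}) (x * y) = \0 x * y + x * \0 y.
Proof. by rewrite /= mul0r mulr0 addr0. Qed.

(** Over the zero derivations of A and B, [der_along] describes A-linear derivations, so the
    rigidity lemma applies to them too. *)
Definition derivation0 (R : comPzRingType) : derivation R :=
  MkDerivation (@derivation0_subproof R).

(** As 1 need not belong to the basis, multiply by 1 (x) e_0, which exists since l >= 1, and read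
    off the coordinate of c (x) e_0. *)
Lemma tens_free_eq0 (A : comPzRingType) (B C : algebra A) (l : nat) (c : C) :
  (1 <= l)%N -> free_of_rank B l -> tens c (1 : B) = 0 -> c = 0.
Proof.
case: l => // l _ [e e_basis] c0.
have : tens c (e ord0) = 0 :> tensor C B.
  by rewrite -[c]mulr1 -[e ord0]mul1r -tensME c0 mul0r.
move=> /(congr1 (tcoord e_basis ord0)).
by rewrite tcoord_tens (bcoord_basis e_basis) rmorph1 mul1r raddf0.
Qed.

Section WeilLie.
Variables (A : comPzRingType) (I : Type) (d : I -> derivation A).
Variables (B : diff_algebra d) (l : nat) (l_ge1 : (1 <= l)%N).
Hypothesis B_free : free_of_rank B l.
Variables (W : weil_descent B) (D : diff_algebra (diff_der B)).
Variable dW : I -> derivation (W D).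
Hypothesis dWP : forall i, is_weil_der i (dW i).
Variables (i j : I) (s : seq I) (c : I -> A).
Hypothesis del0 : forall x,
  @lie_defect A I (restrict_scalars D) (diff_der D) i j s c x = 0.

Let WD : diff_algebra d := weil_diff dWP.

Let P : I -> derivation (restrict_scalars (base_change B WD)) :=
  base_change_der B WD.

(** The unit seen over A, where the structure coefficients live. *)
Let u : alg_hom (restrict_scalars D) (restrict_scalars (base_change B WD)) :=
  @MkAlgHom A (restrict_scalars D) (restrict_scalars (base_change B WD))
    (weil_unit W D) (fun a => alg_hom_map (weil_unit W D) (alg_map B a)).

Let defect_unit x : lie_defect P i j s c (u x) = 0.
Proof.
have uP k : differential (diff_der D k) (P k) u.
  by move=> y; exact: is_weil_der_unit.
rewrite (@lie_defect_map A I i j s c (restrict_scalars D)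
  (restrict_scalars (base_change B WD)) u (diff_der D) P uP).
by rewrite del0 rmorph0.
Qed.

Let defect_tens (w : WD) b : lie_defect P i j s c (tens w b) =
  tens (lie_defect dW i j s c w) b + tens w (lie_defect (diff_der B) i j s c b).
Proof. exact: (lie_defect_tens i j s c (diff_algP WD) (diff_algP B)). Qed.

Let defect_B (w : WD) b : tens w (lie_defect (diff_der B) i j s c b) = 0.
Proof.
suff e0 : tens (1 : WD) (lie_defect (diff_der B) i j s c b) = 0.
  have := tensME w 1 1 (lie_defect (diff_der B) i j s c b).
  by rewrite e0 mulr0 mulr1 mul1r => /esym.
(* The image of b under W_D is 1 (x) b, and E kills 1, so only 1 (x) G(b) remains. *)
have := defect_unit (alg_map D b).
rewrite [u _](alg_hom_map (weil_unit W D)) [LHS]defect_tens.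
by rewrite (lie_defect1 i j s c dW) tens0l add0r.
Qed.

Let defect_A a : lie_defect dW i j s c (alg_map (W D) a) = 0.
Proof.
apply: (tens_free_eq0 l_ge1 B_free).
have := defect_tens (alg_map (W D) a) 1.
rewrite defect_B addr0 => <-.
(* Write a (x) 1 as 1 (x) a, where E acts on 1 and vanishes. *)
rewrite -[alg_map (W D) a]mulr1 tensZ mulr1.
rewrite [LHS]defect_tens defect_B addr0.
by rewrite (lie_defect1 i j s c dW) tens0l.
Qed.

Lemma lie_defect_weil w : lie_defect dW i j s c w = 0.
Proof.
have d0P : differential (derivation0 A) (derivation0 B) (alg_map B).
  by move=> a; rewrite /= rmorph0.
have eP : der_along (derivation0 A) (alg_id (W D)) (lie_defect dW i j s c).
  split; [exact: lie_defectD | exact: lie_defectM |].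
  by move=> a; rewrite defect_A /= rmorph0.
have eP0 : der_along (derivation0 A) (alg_id (W D)) (fun=> 0).
  by split=> [x y|x y|a] /=; rewrite ?(mul0r, mulr0, addr0, rmorph0).
apply: (der_along_weil_inj d0P eP eP0) => x.
have e0 z : tensor_along (alg_id (W D)) (fun=> 0) (derivation0 B) z = 0.
  move: z; apply: tensor_additive_ext => [||y b].
  - exact: (tensor_along_nmod_morphism eP0 d0P).
  - by split=> // y z /=; rewrite addr0.
  - by rewrite (tensor_along_tens eP0 d0P) /= tens0l tens0r addr0.
(* By [defect_B] the part 1 (x) G is zero, so E (x) 1 is all of [P], which vanishes on the image of
   W_D. *)
have eE z : tensor_along (alg_id (W D)) (lie_defect dW i j s c) (derivation0 B) z =
    lie_defect P i j s c z.
  move: z; apply: tensor_additive_ext => [||y b].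
  - exact: (tensor_along_nmod_morphism eP d0P).
  - by apply: nmod_morphism_of_add => y y'; exact: (lie_defectD i j s c P).
  - by rewrite (tensor_along_tens eP d0P) defect_tens defect_B /= tens0r.
by rewrite e0 eE; exact: defect_unit.
Qed.

End WeilLie.

(** The list enumerates the support of a_ij, so it is independent of the algebra and serves both D
    and W(D). *)
Lemma lie_commutingP (A : comPzRingType) (I : choiceType) (a : I -> I -> I -> A) :
  (forall i j, finite_set [set k | a i j k != 0]%classic) ->
  exists s : I -> I -> seq I, forall (R : algebra A) (del : I -> derivation R),
    lie_commuting del a <->
    forall i j x, lie_defect del i j (s i j) (a i j) x = 0.
Proof.
move=> afin; exists (fun i j => enum_fset (fset_set [set k | a i j k != 0]%classic)).
move=> R del.
have sumE i j x : \sum_(k \in [set: I]) alg_map R (a i j k) * del k x =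
    \sum_(k <- fset_set [set k | a i j k != 0]%classic) alg_map R (a i j k) * del k x.
  apply: fsbigTE => k; rewrite in_fset_set// notin_setE /= => /negP/negPn/eqP ->.
  by rewrite rmorph0 mul0r.
split=> [[_ h] i j x|h].
  by rewrite /lie_defect h sumE subrr.
by split=> // i j x; rewrite sumE; apply/eqP; rewrite -subr_eq0; apply/eqP/h.
Qed.

Theorem theorem3p4 (A : comPzRingType) (I : choiceType)
    (d : I -> derivation A) (B : diff_algebra d) (l : nat)
    (l_ge1 : (1 <= l)%N) (B_free : free_of_rank B l) :
  (* the classical Weil descent exists, and for any choice W of it *)
  inhabited (weil_descent B) /\
  forall W : weil_descent B,
  (* the derivations of W(D) induced by those of D are well defined, and *)
  (forall (D : diff_algebra (diff_der B)) (i : I),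
     exists! e : derivation (W D), is_weil_der i e) /\
  forall (dW : forall D : diff_algebra (diff_der B), I -> derivation (W D))
    (dWP : forall (D : diff_algebra (diff_der B)) (i : I),
       is_weil_der i (dW D i)),
  let Wdiff (D : diff_algebra (diff_der B)) : diff_algebra d :=
    weil_diff (dWP D) in
  [/\ (* (i) *)
      exists (Wmap : forall D D' : diff_algebra (diff_der B),
                diff_hom D D' -> diff_hom (Wdiff D) (Wdiff D'))
        (Wmap_id : forall D, Wmap D D (diff_id D) = diff_id (Wdiff D))
        (Wmap_comp : forall D D' D'' (g : diff_hom D' D'')
             (f : diff_hom D D'),
           Wmap D D'' (diff_comp g f) =
           diff_comp (Wmap D' D'' g) (Wmap D D' f)),
        (forall D D' (f : diff_hom D D'),
           @is_weil_map A B W D D' f (Wmap D D' f)) /\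
        left_adjoint
          (@MkFunctor (diff_category (diff_der B)) (diff_category d)
             Wdiff Wmap Wmap_id Wmap_comp)
          (diff_base_change_functor B),
      (* (ii) *)
      forall (C : diff_algebra d) (D : diff_algebra (diff_der B)),
        set_bij [set phi | @is_diff_hom A I d (Wdiff D) C phi]%classic
          [set psi | @is_diff_hom B I (diff_der B)
                       D (diff_base_change B C) psi]%classic
          (@weil_tau A B D (W D) C (weil_unit W D))
    & (* (iii) *)
      forall (D : diff_algebra (diff_der B)) (a : I -> I -> I -> A),
        @lie_commuting A I (restrict_scalars D) (diff_der D) a ->
        @lie_commuting A I (W D) (dW D) a].
Proof.
split=> [|W]; first exact: weil_descent_exists B_free.
split=> [D i|dW dWP]; first exact: is_weil_der_exists_unique.
split.
- exists (@weil_diff_map _ _ _ _ _ _ dWP), (weil_diff_map_id dWP).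
  exists (weil_diff_map_comp dWP); split; last exact: weil_diff_left_adjoint.
  move=> D D' f.
  (* Forgetting derivations in [weil_diff_mapE] leaves the equation of W(f). *)
  exact: (congr1 (@diff_hom_alg _ _ _ _ _) (weil_diff_mapE dWP f)).
- by move=> C D; exact: weil_tau_set_bij.
- move=> D a Da; have [s sP] := lie_commutingP Da.1.
  apply/sP => i j; apply: (lie_defect_weil l_ge1 B_free (dWP D)).
  by move/sP : Da.
Qed.
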